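(* Let $n\ge1$, let $\|\cdot\|$ be a norm on $\mathbb{R}^n$, and let $\varepsilon,\Delta>0$. Let $X$ be an $\mathbb{R}^n$-valued random vector such that the additive mechanism $M_X$ is $\varepsilon$-DP (for sensitivity $\Delta$), and let $X^\star$ be the rearrangement of $X$. Then $M_{X^\star}$ is also $\varepsilon$-DP (for sensitivity $\Delta$). Moreover, $\|X^\star\|\prec\|X\|$.
   Context: For a random vector $X\sim\mu$ in $\mathbb{R}^n$, the additive mechanism $M_X$ (adding $X$ to a query of $\|\cdot\|$-sensitivity $\Delta$) is $\varepsilon$-DP if and only if $\mu(A)\le e^{\varepsilon}\mu(A+u)$ for all Borel $A\subseteq\mathbb{R}^n$ and all $u\in\mathbb{R}^n$ with $\|u\|\le\Delta$; take this as the definition. This condition forces $\mu$ to be absolutely continuous with respect to Lebesgue measure, so $X$ has a density $f$, and it is equivalent to $f$ having a version with $f(x)\le e^{\varepsilon}f(y)$ whenever $\|x-y\|\le\Delta$. Rearrangement: write $|A|$ for Lebesgue measure and $\mathbb{B}=\{x:\|x\|<1\}$. For measurable $A\subseteq\mathbb{R}^n$, $A^\star=\{x\in\mathbb{R}^n:\|x\|<(|A|/|\mathbb{B}|)^{1/n}\}$. For measurable $f:\mathbb{R}^n\to[0,\infty)$, $f^\star(x)=\int_0^\infty \mathbf{1}_{\{f>\lambda\}^\star}(x)\,d\lambda$. If $f$ is a probability density so is $f^\star$, and for $X$ with density $f$, $X^\star$ denotes a random vector with density $f^\star$. Stochastic domination: for non-negative random variables $U,V$, $U\prec V$ means $\Pr(U>\lambda)\le\Pr(V>\lambda)$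 for all $\lambda\ge0$. *)

(* Defs.v *)
From HB Require Import structures.
From mathcomp Require Import all_boot all_order all_algebra.
From mathcomp Require Import all_classical all_reals all_analysis measurable_realfun.
Set Implicit Arguments.
Unset Strict Implicit.
Unset Printing Implicit Defensive.
Import Order.TTheory GRing.Theory Num.Theory.
Import numFieldNormedType.Exports.
Local Open Scope classical_set_scope.
Local Open Scope ring_scope.

(* Borel sigma-algebra on matrices, in particular on the row vectors 'rV[R]_n,
   which model R^n.  The topology is that of the library's sup norm, i.e., the
   usual one. *)
HB.instance Definition _ (R : realType) (m n : nat) :=
  @isMeasurable.Build default_measure_display 'M[R]_(m, n)
    <<s (@open 'M[R]_(m, n)) >> (@sigma_algebra0 _ setT _)
    (@sigma_algebraC _ _) (@sigma_algebra_bigcup _ setT _).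

Section borel_rV.
Context (R : realType).

Lemma open_measurable_mx m n (U : set 'M[R]_(m, n)) : open U -> measurable U.
Proof. by move=> oU; exact: sub_sigma_algebra. Qed.

Definition cons_rV n (p : R * 'rV[R]_n) : 'rV[R]_n.+1 :=
  row_mx (p.1%:M : 'M[R]_1) p.2.

Lemma cons_rV0 n (p : R * 'rV[R]_n) : cons_rV p ord0 ord0 = p.1.
Proof.
have -> : (ord0 : 'I_n.+1) = lshift n (ord0 : 'I_1) by exact: val_inj.
by rewrite [LHS](row_mxEl (p.1%:M : 'M[R]_1) p.2) mxE eqxx mulr1n.
Qed.

Lemma cons_rVS n (p : R * 'rV[R]_n) (i : 'I_n) :
  cons_rV p ord0 (lift ord0 i) = p.2 ord0 i.
Proof.
have -> : lift ord0 i = rshift 1 i by exact: val_inj.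
by rewrite [LHS](row_mxEr (p.1%:M : 'M[R]_1) p.2).
Qed.

Lemma ball_cons_rV n (x : R) (v : 'rV[R]_n) (r : R) : 0 < r ->
  (@cons_rV n) @^-1` ball (cons_rV (x, v)) r = ball x r `*` ball v r.
Proof.
move=> r0; apply/seteqP; split=> [[y w]|[y w] [/= xy vw]].
- move=> h; split=> /=; first by have := h.2 ord0 ord0; rewrite !cons_rV0.
  split=> // i j; have := h.2 i (lift ord0 j).
  by rewrite !(ord1 i) !cons_rVS.
- split=> // i j; rewrite !(ord1 i); case: (unliftP ord0 j) => [k|] ->.
    by rewrite !cons_rVS; have := vw.2 ord0 k.
  by rewrite !cons_rV0.
Qed.

Lemma open_rV_ratball n (U : set 'rV[R]_n) : open U ->
  U = \bigcup_(c in [set c : 'rV[rat]_n * nat |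
         ball (map_mx ratr c.1 : 'rV[R]_n) c.2.+1%:R^-1 `<=` U])
       ball (map_mx ratr c.1 : 'rV[R]_n) c.2.+1%:R^-1.
Proof.
move=> oU; apply/seteqP; split=> [x Ux|x [c /= cU cx]]; last exact: cU.
have /nbhs_ballP[e /= e0 xeU] : nbhs x U by exact: open_nbhs_nbhs.
have [k ke] : exists k : nat, k.+1%:R^-1 < e / 2.
  have e20 : 0 < e / 2 by rewrite divr_gt0.
  exists (Num.trunc (e / 2)^-1); rewrite invf_plt ?posrE//.
  by rewrite truncnS_gt.
have k0 : 0 < (k.+1%:R^-1 : R) by rewrite invr_gt0.
have /choice[q qP] : forall j : 'I_n, exists q : rat,
    (ratr q : R) \in `]x ord0 j - k.+1%:R^-1, x ord0 j + k.+1%:R^-1[.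
  by move=> j; apply: rat_in_itvoo; rewrite ltrD2l gtrN.
pose c : 'rV[rat]_n := \row_j q j.
have xc : ball (map_mx ratr c : 'rV[R]_n) k.+1%:R^-1 x.
  split=> // i j; rewrite (ord1 i) /c !mxE /= /ball /= distrC ltr_distl.
  have := qP j; rewrite in_itv/= => /andP[h1 h2].
  by apply/andP; split; [rewrite ltrBlDr|rewrite -ltrBlDr].
exists (c, k) => //= y yc; apply: xeU.
rewrite (splitr e).
exact: ball_triangle (ball_sym (le_ball (ltW ke) xc)) (le_ball (ltW ke) yc).
Qed.

Lemma measurable_cons_rV n : measurable_fun [set: R * 'rV[R]_n] (@cons_rV n).
Proof.
apply: (@measurability _ _ _ _ _ _ (@open 'rV[R]_n.+1)) => //.
move=> _ [U oU <-]; rewrite setTI (open_rV_ratball oU) preimage_bigcup.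
rewrite bigcup_mkcond; apply: countable_bigcupT_measurable => // -[q k].
case: ifPn => // _ /=.
have [p ->] : exists p, map_mx ratr q = cons_rV p.
  exists (ratr (q ord0 ord0), \row_j ratr (q ord0 (lift ord0 j))).
  apply/rowP => j; rewrite mxE; case: (unliftP ord0 j) => [i|] ->.
    by rewrite cons_rVS mxE.
  by rewrite cons_rV0.
have k0 : 0 < (k.+1%:R^-1 : R) by rewrite invr_gt0.
case: p => x v; rewrite ball_cons_rV//; apply: measurableX.
  by apply: open_measurable; exact: ball_open.
by apply: open_measurable_mx; exact: ball_open.
Qed.

Definition uncons_rV n (v : 'rV[R]_n.+1) : R * 'rV[R]_n :=
  (v ord0 ord0, \row_(j < n) v ord0 (lift ord0 j)).

Lemma cons_rVK n : cancel (@cons_rV n) (@uncons_rV n).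
Proof.
move=> [x v]; rewrite /uncons_rV cons_rV0; congr pair.
by apply/rowP => j; rewrite mxE cons_rVS.
Qed.

Lemma measurable_uncons_rV n : measurable_fun [set: 'rV[R]_n.+1] (@uncons_rV n).
Proof.
apply: measurable_fun_pair.
  apply: (measurability _ (RGenOpens.measurableE R)).
  move=> _ [_ [a [b ->] <-]]; rewrite setTI; apply: open_measurable_mx.
  apply: open_comp; last exact: interval_open.
  by move=> v _; exact: coord_continuous.
apply: (@measurability _ _ _ _ _ _ (@open 'rV[R]_n)) => //.
move=> _ [U oU <-]; rewrite setTI; apply: open_measurable_mx.
rewrite openE => v /= Uv.
have /nbhs_ballP[e /= e0 eU] := open_nbhs_nbhs (conj oU Uv).
apply/nbhs_ballP; exists e => //= w [_ vw]; apply: eU; split=> // i j.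
by rewrite !mxE; exact: vw.
Qed.

End borel_rV.
Arguments cons_rV {R n}.

Section lebesgue_rV_succ.
Context (R : realType) (n : nat) (m : {sigma_finite_measure set 'rV[R]_n -> \bar R}).
Local Open Scope ereal_scope.

Definition lebesgue_rV_succ : set 'rV[R]_n.+1 -> \bar R :=
  pushforward (@lebesgue_measure R \x m) cons_rV.

Let mu0 : lebesgue_rV_succ set0 = 0.
Proof. by rewrite /lebesgue_rV_succ /pushforward preimage_set0 measure0. Qed.

Let mu_ge0 A : 0 <= lebesgue_rV_succ A.
Proof. exact: integral_ge0. Qed.

Let mu_sigma_additive : semi_sigma_additive lebesgue_rV_succ.
Proof.
have mpre (A : set 'rV[R]_n.+1) : measurable A ->
    measurable (@cons_rV R n @^-1` A).
  by move=> mA; rewrite -[X in measurable X]setTI; exact: measurable_cons_rV.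
move=> F mF tF mUF; rewrite /lebesgue_rV_succ /pushforward preimage_bigcup.
apply: measure_semi_sigma_additive.
- by move=> k; exact: mpre.
- apply/trivIsetP => /= i j _ _ ij; rewrite -preimage_setI.
  by move/trivIsetP : tF => /(_ _ _ _ _ ij) ->//; rewrite preimage_set0.
- by rewrite -preimage_bigcup; exact: mpre.
Qed.

HB.instance Definition _ := isMeasure.Build _ _ _ lebesgue_rV_succ
  mu0 mu_ge0 mu_sigma_additive.

Let mu_sigma_finite : sigma_finite setT lebesgue_rV_succ.
Proof.
have /sigma_finiteP[F [TF ndF Foo]] := sigma_finiteT (@lebesgue_measure R).
have /sigma_finiteP[G [TG ndG Goo]] := sigma_finiteT m.
exists (fun k => @uncons_rV R n @^-1` (F k `*` G k)).
  rewrite -preimage_bigcup -(preimage_setT (@uncons_rV R n)); congr (_ @^-1` _).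
  rewrite -setXTT TF TG; apply/seteqP; split=> [[x y]|[x y] [k _ []]].
    move=> [/= [i _ Fix] [j _ Gjy]]; exists (maxn i j) => //; split.
      by move: x Fix; exact/subsetPset/ndF/leq_maxl.
    by move: y Gjy; exact/subsetPset/ndG/leq_maxr.
  by split; exists k.
move=> k; have [mF Fk] := Foo k; have [mG Gk] := Goo k; split.
  rewrite -[X in measurable X]setTI; apply: measurable_uncons_rV => //.
  exact: measurableX.
rewrite /lebesgue_rV_succ /pushforward -comp_preimage.
rewrite (_ : _ \o _ = id); last by apply/funext => x /=; exact: cons_rVK.
by rewrite preimage_id product_measure1E// lte_mul_pinfty// ge0_fin_numE.
Qed.

HB.instance Definition _ := Measure_isSigmaFinite.Build _ _ _ lebesgue_rV_succ
  mu_sigma_finite.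

End lebesgue_rV_succ.

(* n-dimensional Lebesgue measure on Borel sets, as the n-fold product of the
   one-dimensional one. *)
Fixpoint lebesgue_rV (R : realType) (n : nat) :
    {sigma_finite_measure set 'rV[R]_n -> \bar R} :=
  match n with
  | 0 => \d_(0 : 'rV[R]_0)
  | n'.+1 => lebesgue_rV_succ (lebesgue_rV R n')
  end.

Lemma lebesgue_rV_ball (R : realType) n (v : 'rV[R]_n) (r : R) : 0 < r ->
  lebesgue_rV R n (ball v r) = ((r *+ 2) ^+ n)%:E.
Proof.
move=> r0; elim: n => [|n IH] in v *.
  rewrite /= expr0 diracE mem_set//; split=> // i; first by case.
rewrite /= /lebesgue_rV_succ /pushforward.
have -> : v = cons_rV (uncons_rV v).
  apply/rowP => j; case: (unliftP ord0 j) => [i|] ->.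
    by rewrite cons_rVS mxE.
  by rewrite cons_rV0.
rewrite ball_cons_rV// product_measure1E.
- by rewrite IH exprS EFinM; congr mule; exact/lebesgue_measure_ball/ltW.
- by apply: open_measurable; exact: ball_open.
- by apply: open_measurable_mx; exact: ball_open.
Qed.

Section rearrangement.
Context (R : realType) (n : nat).
Local Notation V := 'rV[R]_n.
Local Notation leb := (lebesgue_rV R n).

(* Non-negativity and N 0 = 0 follow from these axioms. *)
Record is_norm (N : V -> R) : Prop := IsNorm {
  norm_triangle : forall x y, N (x + y) <= N x + N y ;
  norm_homogeneous : forall a x, N (a *: x) = `|a| * N x ;
  norm_definite : forall x, N x = 0 -> x = 0 }.

Variable N : V -> R.

(* [mu] is the law of the noise. *)
Definition eps_DP (Delta eps : R) (mu : set V -> \bar R) : Prop :=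
  forall (A : set V) (u : V), measurable A -> N u <= Delta ->
    (mu A <= (expR eps)%:E * mu [set (x + u)%R | x in A])%E.

(* The radius is computed in \bar R, so that [set_star A] is the whole space
   when [A] has infinite measure. *)
Definition set_star (A : set V) : set V :=
  [set x | ((N x)%:E < (leb A / leb [set y | N y < 1]%R) `^ n%:R^-1)%E].

(* May take the value +oo, at the origin, when [f] is unbounded. *)
Definition fun_star (f : V -> R) (x : V) : \bar R :=
  (\int[lebesgue_measure]_(l in `[0%R, +oo[)
     (\1_(set_star [set y | l < f y]%R) x)%:E)%E.

Definition has_density (mu : set V -> \bar R) (f : V -> \bar R) : Prop :=
  [/\ measurable_fun setT f, (forall x, 0 <= f x)%E &
      forall A, measurable A -> mu A = (\int[leb]_(x in A) f x)%E].

(* A law [mu] has a density only up to null sets, but [fun_star f] depends only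
   on the class of [f]: all choices of [f] give the same law [nu]. *)
Definition is_rearrangement (mu nu : set V -> \bar R) : Prop :=
  exists f : V -> R,
    has_density mu (EFin \o f) /\ has_density nu (fun_star f).

End rearrangement.

(* [stoch_dom P P' U U'] is U \prec U'. *)
Definition stoch_dom d d' (T : measurableType d) (T' : measurableType d')
    (R : realType) (P : probability T R) (P' : probability T' R)
    (U : T -> R) (U' : T' -> R) : Prop :=
  forall l : R, 0 <= l ->
    (P [set t | (l < U t)%R] <= P' [set t | (l < U' t)%R])%E.

(* Main.v *)
(* The superlevel sets E_l of a density f of the noise shrink fast enough: by
   the privacy condition every translate of E_(e^eps l) by u with N u <= Delta
   lies in E_l up to a null set.  By Fubini, E_l then contains, up to a null
   set, the sum of almost all of E_(e^eps l) and the open ball of radius Delta,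
   so Brunn-Minkowski makes the radius of the ball E_l^* exceed that of
   E_(e^eps l)^* by at least Delta.  Since f^*(x) is the length of the set of l
   with x in E_l^*, this gives f^*(x) <= e^eps f^*(x + u).

   Brunn-Minkowski is proved in the form
     |C| >= (|A| / (1 - t)^n)^(1 - t) (|B| / t^n)^t   for A + B included in C,
   by induction on n through the one-dimensional Prekopa-Leindler inequality
   applied to the volumes of the sections.

   Domination: E_l^* and {N <= c} are nested and |E_l^*| = |E_l|, hence
   |E_l^* /\ {N <= c}| >= |E_l /\ {N <= c}|; integrate over l. *)

From HB Require Import structures.
Require Import Defs.
From mathcomp Require Import all_boot all_order all_algebra.
From mathcomp Require Import all_classical all_reals all_analysis measurable_realfun.
From mathcomp Require Import ring lra.
Set Implicit Arguments.
Unset Strict Implicit.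
Unset Printing Implicit Defensive.
Import Order.TTheory GRing.Theory Num.Theory.
Import numFieldNormedType.Exports.
Local Open Scope classical_set_scope.
Local Open Scope ring_scope.

(** * Sections, layer cake and affine maps *)

Section sections_tonelli.
Local Open Scope ereal_scope.
Context d1 d2 (T1 : measurableType d1) (T2 : measurableType d2) (R : realType)
  (m1 : {sigma_finite_measure set T1 -> \bar R})
  (m2 : {sigma_finite_measure set T2 -> \bar R}).

(** Both sides compute the product measure of the part of [A] over [K] and [D], slicing it in either
    direction. The same exchange later swaps points with levels and points with translation
    vectors. *)
Lemma sections_tonelli (A : set (T1 * T2)) (K : set T1) (D : set T2) :
  measurable A -> measurable K -> measurable D ->
  \int[m1]_(x in K) m2 (D `&` [set y | A (x, y)]) =
  \int[m2]_(y in D) m1 (K `&` [set x | A (x, y)]).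
Proof.
move=> mA mK mD; rewrite integral_mkcond [RHS]integral_mkcond.
have mKDA : measurable ((K `*` D) `&` A) by apply: measurableI => //; exact: measurableX.
have := indic_fubini_tonelli m1 m2 mKDA.
rewrite indic_fubini_tonelli_FE// indic_fubini_tonelli_GE// => E.
rewrite [LHS](eq_integral (m2 \o xsection (K `*` D `&` A))) ?E; last first.
  move=> x _; rewrite patchE/= xsectionE; case: ifPn => [/set_mem Kx|/negP Kx].
    by congr (m2 _); apply/seteqP; split=> y /=; tauto.
  rewrite [X in m2 X](_ : _ = set0) ?measure0// -subset0 => y [[/= Kx' _] _].
  by apply: Kx; rewrite inE.
apply: eq_integral => y _; rewrite patchE/= ysectionE.
case: ifPn => [/set_mem Dy|/negP Dy].
  by congr (m1 _); apply/seteqP; split=> x /=; tauto.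
rewrite [X in m1 X](_ : _ = set0) ?measure0// -subset0 => x [[/= _ Dy'] _].
by apply: Dy; rewrite inE.
Qed.

Lemma measurable_fun_section_fst (A : set (T1 * T2)) (D : set T2) :
  measurable A -> measurable D ->
  measurable_fun setT (fun x => m2 (D `&` [set y | A (x, y)])).
Proof.
move=> mA mD; have mDA : measurable ((setT `*` D) `&` A).
  by apply: measurableI => //; exact: measurableX.
have := measurable_fun_xsection m2 mDA; congr measurable_fun.
apply/funext => x /=; congr (m2 _); rewrite xsectionE.
by apply/seteqP; split=> [y [[]]|y []].
Qed.

Lemma measurable_fun_section_snd (A : set (T1 * T2)) (K : set T1) :
  measurable A -> measurable K ->
  measurable_fun setT (fun y => m1 (K `&` [set x | A (x, y)])).
Proof.
move=> mA mK; have mKA : measurable ((K `*` setT) `&` A).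
  by apply: measurableI => //; exact: measurableX.
have := measurable_fun_ysection m1 mKA; congr measurable_fun.
apply/funext => y /=; congr (m1 _); rewrite ysectionE.
by apply/seteqP; split=> [x [[]]|x []].
Qed.

End sections_tonelli.

Section layer_cake.
Local Open Scope ereal_scope.
Context d (T : measurableType d) (R : realType)
  (mu : {sigma_finite_measure set T -> \bar R}) (f : T -> \bar R)
  (mf : measurable_fun setT f) (f0 : forall x, 0 <= f x).

Lemma measurable_hypograph :
  measurable [set p : T * measurableTypeR R | p.2%:E < f p.1].
Proof.
rewrite -[X in measurable X]setTI.
apply: (@measurable_lte _ _ R setT measurableT
  (fun p : T * measurableTypeR R => (p.2 : R)%:E) (fun p => f p.1)).
  by apply/measurable_EFinP; exact: measurable_snd.
by apply: (measurableT_comp mf); exact: measurable_fst.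
Qed.

Lemma lebesgue_measure_lt_ereal (y : \bar R) : 0 <= y ->
  @lebesgue_measure R (`]0%R, +oo[ `&` [set l | l%:E < y]) = y.
Proof.
case: y => [r| |]// r0.
- rewrite (_ : _ `&` _ = `]0%R, r[%classic).
    rewrite lebesgue_measure_itv/= lte_fin; move: r0; rewrite lee_fin le_eqVlt.
    by case/predU1P => [<-|->]; rewrite ?ltxx// sube0.
  apply/seteqP; split=> l /=; rewrite !in_itv/= andbT lte_fin; first by case=> -> ->.
  by case/andP.
- rewrite (_ : _ `&` _ = `]0%R, +oo[%classic) ?lebesgue_measure_itv/= ?ltry//.
  by rewrite setIidl// => l _ /=; rewrite ltry.
Qed.

(** [f x] is the length of the set of positive levels below it, also when it is infinite; Tonelli on
    the hypograph swaps points and levels. *)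
Lemma ge0_integral_layer_cake (K : set T) : measurable K ->
  \int[mu]_(x in K) f x =
  \int[lebesgue_measure]_(l in `]0%R, +oo[) mu (K `&` [set x | l%:E < f x]).
Proof.
move=> mK.
rewrite -(@sections_tonelli _ _ _ _ _ mu (@lebesgue_measure R)
  [set p : T * measurableTypeR R | p.2%:E < f p.1])//.
- by apply: eq_integral => x _ /=; rewrite lebesgue_measure_lt_ereal.
- exact: measurable_hypograph.
Qed.

End layer_cake.

(** Change of variables: the hypothesis on [phi] says that [k] times the image of [m] under [phi] is
    [m] itself. *)
Lemma ge0_integral_scaling d (T : measurableType d) (R : realType)
    (m : {measure set T -> \bar R}) (phi : T -> T) (k : R) (f : T -> \bar R) :
  0 <= k -> measurable_fun setT phi ->
  (forall A, measurable A -> (k%:E * m (phi @^-1` A) = m A)%E) ->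
  measurable_fun setT f -> (forall x, 0 <= f x)%E ->
  (k%:E * \int[m]_x f (phi x) = \int[m]_x f x)%E.
Proof.
move=> k0 mphi phiE mf f0.
unshelve epose (nu := mscale (NngNum k0) (pushforward m phi)); first exact: mphi.
transitivity (\int[nu]_x f x)%E; last first.
  by apply: eq_measure_integral => A mA _; rewrite -phiE.
by rewrite ge0_integral_mscale// [in RHS]ge0_integral_pushforward.
Qed.

Section measurable_rV.
Context (R : realType).

(** An open set is a countable union of rational balls, and a ball of the sup norm is a finite
    intersection of conditions on single coordinates. *)
Lemma measurable_fun_rV d (T : measurableType d) n (f : T -> 'rV[R]_n) :
  (forall j, measurable_fun setT (fun t => f t ord0 j)) -> measurable_fun setT f.
Proof.
move=> mf; apply: (@measurability _ _ _ _ _ _ (@open 'rV[R]_n)) => //.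
move=> _ [U oU <-]; rewrite setTI (open_rV_ratball oU) preimage_bigcup.
rewrite bigcup_mkcond; apply: countable_bigcupT_measurable => // -[q k].
case: ifPn => // _ /=.
have k0 : 0 < (k.+1%:R^-1 : R) by rewrite invr_gt0.
rewrite [X in measurable X](_ : _ = \bigcap_(j in [set: 'I_n])
   ((fun t => f t ord0 j) @^-1` ball (ratr (q ord0 j) : R) k.+1%:R^-1)); last first.
  apply/seteqP; split=> [t [_ h] j _ /=|t h].
    by have := h ord0 j; rewrite mxE.
  by split=> // i j; rewrite (ord1 i) mxE; exact: (h j I).
apply: fin_bigcap_measurable => // j _.
rewrite -[X in measurable X]setTI; apply: mf => //.
by apply: open_measurable; exact: ball_open.
Qed.

Lemma measurable_coord n (j : 'I_n) :
  measurable_fun setT (fun v : 'rV[R]_n => v ord0 j).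
Proof.
apply: (measurability _ (RGenOpens.measurableE R)).
move=> _ [_ [a [b ->] <-]]; rewrite setTI; apply: open_measurable_mx.
apply: open_comp; last exact: interval_open.
by move=> v _; exact: coord_continuous.
Qed.

Lemma measurable_rVB d (T : measurableType d) n (f g : T -> 'rV[R]_n) :
  measurable_fun setT f -> measurable_fun setT g ->
  measurable_fun setT (fun t => f t - g t).
Proof.
move=> mf mg; apply: measurable_fun_rV => j.
rewrite [X in measurable_fun _ X](_ : _ =
  fun t => f t ord0 j - g t ord0 j); last first.
  by apply/funext => t; rewrite !mxE.
apply: measurable_funB.
- exact: (measurableT_comp (@measurable_coord n j) mf).
- exact: (measurableT_comp (@measurable_coord n j) mg).
Qed.

Lemma measurable_rV_affine n (a : R) (v : 'rV[R]_n) :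
  measurable_fun setT (fun x : 'rV[R]_n => a *: x + v).
Proof.
apply: measurable_fun_rV => j.
rewrite [X in measurable_fun _ X](_ : _ =
  fun x : 'rV[R]_n => a * x ord0 j + v ord0 j); last first.
  by apply/funext => t; rewrite !mxE.
apply: measurable_funD => //; apply: measurable_funM => //.
exact: measurable_coord.
Qed.

Lemma measurable_preimage_affine n (a : R) (v : 'rV[R]_n) (A : set 'rV[R]_n) :
  measurable A -> measurable [set x | A (a *: x + v)].
Proof.
by move=> mA; have := @measurable_rV_affine n a v measurableT _ mA; rewrite setTI.
Qed.

End measurable_rV.

Section lebesgue_affine.
Context (R : realType).
Local Open Scope ereal_scope.

Let mult1 (a b : R) := (fun x => a * x + b)%R : R -> measurableTypeR R.

Let measurable_mult1 a b : measurable_fun setT (mult1 a b).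
Proof. by apply: measurable_funD => //; exact: measurable_funM. Qed.

(** The scaled image measure agrees with Lebesgue measure on half-open intervals, hence everywhere
    by uniqueness. *)
Lemma lebesgue_measure_affine (a b : R) (A : set R) : a != 0%R ->
  measurable A ->
  `|a|%:E * lebesgue_measure [set x | A (a * x + b)%R] = lebesgue_measure A.
Proof.
move=> a0 mA.
unshelve epose (nu := mscale (NngNum (normr_ge0 a))
  (pushforward (@lebesgue_measure R) (mult1 a b))); first exact: measurable_mult1.
transitivity (nu A) => //.
apply/esym/lebesgue_measure_unique => // _ [[c d]] /= _ <-.
rewrite /nu /mscale /pushforward/=.
have aK (y : R) : (a * (a^-1 * y) = y)%R by rewrite mulrA mulfV ?mul1r.
case: (ltgtP a 0%R) a0 => // a0 _.
(* A negative factor swaps the endpoints, so the preimage is closed on the left; its length is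
   unaffected. *)
- rewrite [X in _ * lebesgue_measure X](_ : _ =
    `[((d - b) / a)%R, ((c - b) / a)%R[%classic); last first.
    apply/seteqP; split=> x /=; rewrite !in_itv/= /mult1 ler_ndivrMr// ltr_ndivlMr//;
    by rewrite (mulrC x) lerBrDr ltrBlDr andbC.
  rewrite !lebesgue_measure_itv/= !lte_fin ltr_ndivrMr// divfK ?lt_eqF//.
  rewrite ltrBlDr subrK; case: ifPn => // cd; last by rewrite mule0.
  rewrite -!EFinB -EFinM ltr0_norm//; congr EFin.
  field.
  by rewrite lt_eqF.
- rewrite [X in _ * lebesgue_measure X](_ : _ =
    `]((c - b) / a)%R, ((d - b) / a)%R]%classic); last first.
    apply/seteqP; split=> x /=; rewrite !in_itv/= /mult1 ler_pdivlMr// ltr_pdivrMr//;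
    by rewrite (mulrC x) lerBrDr ltrBlDr.
  rewrite !lebesgue_measure_itv/= !lte_fin ltr_pdivrMr// divfK ?gt_eqF//.
  rewrite ltrBlDr subrK; case: ifPn => // cd; last by rewrite mule0.
  rewrite -!EFinB -EFinM gtr0_norm//; congr EFin.
  field.
  by rewrite gt_eqF.
Qed.

End lebesgue_affine.

Section lebesgue_rV_theory.
Context (R : realType).
Local Open Scope ereal_scope.

Lemma cons_rV_affine n (a : R) (p q : R * 'rV[R]_n) :
  (a *: cons_rV p + cons_rV q = cons_rV (a * p.1 + q.1, a *: p.2 + q.2))%R.
Proof.
apply/rowP => j; rewrite [LHS]mxE [X in (X + _)%R]mxE.
case: (unliftP ord0 j) => [i|] ->; first by rewrite !cons_rVS !mxE.
by rewrite !cons_rV0.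
Qed.

Lemma uncons_rVK n : cancel (@uncons_rV R n) cons_rV.
Proof.
move=> v; apply/rowP => j; case: (unliftP ord0 j) => [i|] ->.
  by rewrite cons_rVS mxE.
by rewrite cons_rV0.
Qed.

Lemma measurable_preimage_cons_rV n (A : set 'rV[R]_n.+1) : measurable A ->
  measurable (cons_rV @^-1` A).
Proof.
by move=> mA; rewrite -[X in measurable X]setTI; exact: measurable_cons_rV.
Qed.

Lemma measurable_rV_section n (A : set 'rV[R]_n.+1) (s : R) : measurable A ->
  measurable [set w | A (cons_rV (s, w))].
Proof.
move=> /measurable_preimage_cons_rV/(measurable_xsection s); congr measurable.
by apply/seteqP; split => w /=; rewrite /xsection/= inE.
Qed.

Lemma measurable_fun_rV_section n (A : set 'rV[R]_n.+1) : measurable A ->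
  measurable_fun setT (fun s => lebesgue_rV R n [set w | A (cons_rV (s, w))]).
Proof.
move=> /measurable_preimage_cons_rV mA.
have := measurable_fun_xsection (lebesgue_rV R n) mA.
congr measurable_fun; apply/funext => s /=; congr (lebesgue_rV R n _).
by apply/seteqP; split => w /=; rewrite /xsection/= inE.
Qed.

Lemma lebesgue_rVS n (A : set 'rV[R]_n.+1) :
  lebesgue_rV R n.+1 A =
  \int[lebesgue_measure]_s lebesgue_rV R n [set w | A (cons_rV (s, w))].
Proof.
rewrite [LHS]/= /lebesgue_rV_succ /pushforward /product_measure1.
apply: eq_integral => s _ /=; congr (lebesgue_rV R n _).
by apply/seteqP; split => w /=; rewrite /xsection/= inE.
Qed.

(** The map acts separately on the first coordinate and on the tail: induction gives the factor
    $|a|^n$ for the tail, and a change of variables in the outer integral gives one more $|a|$. *)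
Lemma lebesgue_rV_affine n (a : R) (v : 'rV[R]_n) (A : set 'rV[R]_n) :
  a != 0%R -> measurable A ->
  (`|a| ^+ n)%:E * lebesgue_rV R n [set x | A (a *: x + v)%R] =
  lebesgue_rV R n A.
Proof.
move=> a0; elim: n => [|n IH] in v A *.
  move=> _; rewrite expr0 mul1e; congr (lebesgue_rV R 0 _).
  by apply/seteqP; split=> x /=; rewrite (thinmx0 x) (thinmx0 (_ + _)%R).
move=> mA; rewrite 2!lebesgue_rVS.
rewrite exprS EFinM -muleA -ge0_integralZl//; last first.
  apply: measurable_fun_rV_section; exact: measurable_preimage_affine.
pose g s := lebesgue_rV R n [set w | A (cons_rV (s, w))].
transitivity (`|a|%:E *
    \int[@lebesgue_measure R]_s g (a * s + (uncons_rV v).1)%R).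
  congr mule; apply: eq_integral => s _.
  have consE w : (a *: cons_rV (s, w) + v = cons_rV
      (a * s + (uncons_rV v).1, a *: w + (uncons_rV v).2))%R.
    by rewrite -[in LHS](uncons_rVK v) cons_rV_affine.
  rewrite /=; under eq_set do rewrite consE.
  rewrite (IH _ [set w | A (cons_rV ((a * s + (uncons_rV v).1)%R, w))])//.
  exact: measurable_rV_section.
rewrite (@ge0_integral_scaling _ _ _ lebesgue_measure
  (fun s => (a * s + (uncons_rV v).1)%R) `|a| g)//.
- by apply: measurable_funD => //; exact: measurable_funM.
- by move=> B mB; exact: lebesgue_measure_affine.
- exact: measurable_fun_rV_section.
Qed.

Lemma lebesgue_rV_translate n (v : 'rV[R]_n) (A : set 'rV[R]_n) : measurable A ->
  lebesgue_rV R n [set x | A (x + v)%R] = lebesgue_rV R n A.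
Proof.
move=> mA; rewrite -[RHS](@lebesgue_rV_affine _ 1 v)// ?oner_neq0//.
by rewrite normr1 expr1n mul1e; under [in RHS]eq_set do rewrite scale1r.
Qed.

Lemma lebesgue_rV_reflect n (v : 'rV[R]_n) (A : set 'rV[R]_n) : measurable A ->
  lebesgue_rV R n [set x | A (v - x)%R] = lebesgue_rV R n A.
Proof.
move=> mA; rewrite -[RHS](@lebesgue_rV_affine _ (-1) v)// ?oppr_eq0 ?oner_neq0//.
rewrite normrN1 expr1n mul1e; under [in RHS]eq_set do rewrite scaleN1r.
by under eq_set do rewrite addrC.
Qed.

End lebesgue_rV_theory.

(** * The Brunn-Minkowski inequality *)

Section sumset_line.
Context (R : realType).
Local Open Scope ereal_scope.
Notation leb := (@lebesgue_measure R).

Lemma lebesgue_measure_translate (b : R) (A : set R) : measurable A ->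
  leb [set x | A (x + b)%R] = leb A.
Proof.
move=> mA; rewrite -[RHS](@lebesgue_measure_affine _ 1 b)// ?oner_neq0//.
by rewrite normr1 mul1e; under [in RHS]eq_set do rewrite mul1r.
Qed.

Lemma measurable_shift (b : R) (A : set R) : measurable A ->
  measurable [set x | A (x + b)%R].
Proof.
move=> mA; have /(_ measurableT _ mA) : measurable_fun setT (fun x : R => (x + b)%R).
  exact: measurable_funD.
by rewrite setTI.
Qed.

(* Translates of [A] and [B] fit into [C] and overlap in an interval whose
   length is as small as we wish. *)
Lemma lebesgue_sumset_ge (A B C : set R) :
  measurable A -> measurable B -> measurable C ->
  has_sup A -> has_inf B -> (forall x y, A x -> B y -> C (x + y)%R) ->
  leb A + leb B <= leb C.
Proof.
move=> mA mB mC supA infB ABC; apply/lee_addgt0Pr => e e0.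
have e20 : (0 < e / 2)%R by rewrite divr_gt0.
have [a Aa supa] := sup_adherent e20 supA.
have [b Bb infb] := inf_adherent e20 infB.
(* [A + b] lies below [sup A + b] and [B + a] lies above [a + inf B]. These translates, both
   contained in [C], can meet only in [I], whose length is less than [e]. *)
pose I : set R := `[(a + inf B)%R, (sup A + b)%R]%classic.
pose A1 := [set x | A (x - b)%R] `\` I.
pose B1 := [set x | B (x - a)%R].
have mI : measurable I by exact: measurable_itv.
have mB1 : measurable B1 by exact: measurable_shift.
have mA1 : measurable A1 by apply: measurableD => //; exact: measurable_shift.
have leI : leb I <= e%:E.
  rewrite /I lebesgue_measure_itv/= lte_fin; case: ifPn => _; last first.
    by rewrite lee_fin ltW.
  by rewrite -EFinB lee_fin; lra.
have leA : leb A <= leb A1 + e%:E.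
  rewrite -(lebesgue_measure_translate (- b) mA).
  apply: (@le_trans _ _ (leb A1 + leb I)); last exact: leeD2l.
  apply: (@le_trans _ _ (leb (A1 `|` I))); last exact: measureU2.
  apply: le_measure; rewrite ?inE//; first exact: measurable_shift.
    exact: measurableU.
  by move=> x Ax; rewrite setUC; have [Ix|Ix] := pselect (I x); [left|right].
rewrite -(lebesgue_measure_translate (- a) mB).
apply: (@le_trans _ _ ((leb A1 + e%:E) + leb B1)); first exact: leeD2r.
rewrite addeAC; apply: leeD2r; rewrite -measureU//; last first.
  rewrite -subset0 => x [[Ax Ix] Bx]; apply: Ix.
  rewrite /I/= in_itv/=; apply/andP; split.
    by rewrite -lerBrDl; exact: (ge_inf infB.2).
  by rewrite -lerBlDr; exact: (ub_le_sup supA.2).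
apply: le_measure; rewrite ?inE//; first exact: measurableU.
move=> x [[Ax _]|Bx]; first by rewrite -(subrK b x); exact: ABC.
by rewrite -(subrK a x) addrC; exact: ABC.
Qed.

(* One-dimensional Prekopa-Leindler inequality in additive form; normalising the
   suprema to 1 reduces it to [lebesgue_sumset_ge] for superlevel sets. *)
Lemma integral_sumset_ge (f g h : R -> \bar R) (k : R) :
  measurable_fun setT f -> measurable_fun setT g -> measurable_fun setT h ->
  (forall x, 0 <= f x <= 1) -> (forall x, 0 <= g x <= 1) ->
  (forall x, 0 <= h x) ->
  (forall x, 0 < f x -> (x <= k)%R) -> (forall x, 0 < g x -> (- k <= x)%R) ->
  (forall l, (l < 1)%R -> exists x, l%:E < f x) ->
  (forall l, (l < 1)%R -> exists x, l%:E < g x) ->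
  (forall l x y, (0 < l)%R -> l%:E < f x -> l%:E < g y -> l%:E < h (x + y)%R) ->
  \int[leb]_x f x + \int[leb]_x g x <= \int[leb]_x h x.
Proof.
move=> mf mg mh f01 g01 h0 fk gk supf supg fgh.
have f0 x : 0 <= f x by case/andP : (f01 x).
have g0 x : 0 <= g x by case/andP : (g01 x).
have mlt (u : R -> \bar R) l : measurable_fun setT u ->
    measurable [set x | l%:E < u x].
  by move=> mu; rewrite -[X in measurable X]setTI; exact: emeasurable_fun_o_infty.
have mcake (u : R -> \bar R) : measurable_fun setT u ->
    measurable_fun (`]0%R, +oo[%classic : set R) (fun l : R => leb [set x | l%:E < u x]).
  move=> mu; apply: measurable_funTS.
  have := @measurable_fun_ysection _ _ _ _ _ leb _ (measurable_hypograph mu).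
  congr measurable_fun; apply/funext => l /=; rewrite ysectionE.
  by congr (leb _).
have cake (u : R -> \bar R) : measurable_fun setT u -> (forall x, 0 <= u x) ->
    \int[leb]_x u x = \int[leb]_(l in `]0%R, +oo[) leb [set x | l%:E < u x].
  move=> mu u0; rewrite ge0_integral_layer_cake//.
  by under eq_integral do rewrite setTI.
rewrite (cake f)// (cake g)// (cake h)//.
rewrite -ge0_integralD//; [|exact: mcake..].
apply: ge0_le_integral => //.
- by move=> l _; rewrite adde_ge0.
- by apply: emeasurable_funD; exact: mcake.
- exact: mcake.
move=> l; rewrite /= in_itv/= andbT => l0.
(* From level 1 on, the superlevel sets of [f] and [g] are empty; below it the suprema make them
   nonempty, as the sumset bound requires. *)
have [l1|l1] := leP 1%R l.
  have le1 (u : R -> \bar R) : (forall x, 0 <= u x <= 1) ->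
      [set x | l%:E < u x] = set0.
    move=> u1; rewrite -subset0 => x /= lu.
    have := lt_le_trans lu (andP (u1 x)).2.
    by rewrite lte_fin ltNge l1.
  by rewrite (le1 f)// (le1 g)// measure0 adde0.
apply: lebesgue_sumset_ge; try exact: mlt.
- split; first by have [x] := supf _ l1; exists x.
  by exists k => x /= lx; apply: fk; apply: lt_trans lx; rewrite lte_fin.
- split; first by have [x] := supg _ l1; exists x.
  by exists (- k)%R => x /= lx; apply: gk; apply: lt_trans lx; rewrite lte_fin.
- by move=> x y; exact: fgh.
Qed.

End sumset_line.

Section weighted_geometric_mean.
Context (R : realType) (t : R).
Hypothesis t01 : 0 < t < 1.

Definition wgm (x y : R) : R := x `^ (1 - t) * y `^ t.

Let t0 : 0 < t. Proof. by case/andP : t01. Qed.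
Let t1 : 0 < 1 - t. Proof. by rewrite subr_gt0; case/andP : t01. Qed.

Lemma wgm_gt0 x y : 0 < x -> 0 < y -> 0 < wgm x y.
Proof. by move=> x0 y0; rewrite mulr_gt0// powR_gt0. Qed.

Lemma wgm0x y : wgm 0 y = 0.
Proof. by rewrite /wgm powR0 ?mul0r// gt_eqF. Qed.

Lemma wgmx0 x : wgm x 0 = 0.
Proof. by rewrite /wgm powR0 ?mulr0// gt_eqF. Qed.

Lemma wgmxx x : 0 < x -> wgm x x = x.
Proof.
move=> x0; rewrite /wgm -powRD ?subrK ?powRr1//; first exact: ltW.
by rewrite oner_eq0.
Qed.

Lemma wgmM x y x' y' : 0 <= x -> 0 <= y -> 0 <= x' -> 0 <= y' ->
  wgm (x * x') (y * y') = wgm x y * wgm x' y'.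
Proof. by move=> *; rewrite /wgm !powRM// mulrACA. Qed.

Lemma ler_wgm x y x' y' : 0 <= x <= x' -> 0 <= y <= y' ->
  wgm x y <= wgm x' y'.
Proof.
move=> /andP[x0 xx'] /andP[y0 yy']; have x'0 := le_trans x0 xx'.
have y'0 := le_trans y0 yy'.
by apply: ler_pM; rewrite ?powR_ge0//; apply: ge0_ler_powR; rewrite ?nnegrE// ltW.
Qed.

Lemma ltr_wgm x y x' y' : 0 <= x < x' -> 0 <= y < y' -> wgm x y < wgm x' y'.
Proof.
move=> /andP[x0 xx'] /andP[y0 yy']; have x'0 := le_lt_trans x0 xx'.
have y'0 := le_lt_trans y0 yy'.
by apply: ltr_pM; rewrite ?powR_ge0//; apply: gt0_ltr_powR; rewrite ?nnegrE// ltW.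
Qed.

(** Weighted AM-GM, as Young's inequality with conjugate exponents [1 / (1 - t)] and [1 / t] applied
    to the two factors of the mean. *)
Lemma wgm_le_add x y : 0 <= x -> 0 <= y -> wgm (x / (1 - t)) (y / t) <= x + y.
Proof.
move=> x0 y0; have xt : 0 <= x / (1 - t) by rewrite divr_ge0// ltW.
have yt : 0 <= y / t by rewrite divr_ge0// ltW.
have := @conjugate_powR _ ((x / (1 - t)) `^ (1 - t)) ((y / t) `^ t)
  (1 - t)^-1 t^-1 (powR_ge0 _ _) (powR_ge0 _ _).
rewrite !invr_gt0 t0 t1 !invrK subrK => /(_ isT isT erefl).
rewrite -!powRrM !mulfV ?gt_eqF// !powRr1// !divfK ?gt_eqF//.
Qed.

End weighted_geometric_mean.

Section brunn_minkowski.
Context (R : realType).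
Local Open Scope ereal_scope.

Lemma ball_consP n (x : R) (v : 'rV[R]_n) (k : R) : (0 < k)%R ->
  ball (0%R : 'rV[R]_n.+1) k (cons_rV (x, v)) ->
  (`|x| < k)%R /\ ball (0%R : 'rV[R]_n) k v.
Proof.
move=> k0; have -> : (0 : 'rV[R]_n.+1)%R = cons_rV (0%R, 0%R).
  apply/rowP => j; case: (unliftP ord0 j) => [i|] ->.
    by rewrite cons_rVS !mxE.
  by rewrite cons_rV0 mxE.
have /seteqP[+ _] := ball_cons_rV (0%R : R) (0%R : 'rV[R]_n) k0.
move=> /(_ (x, v))/= h /h[]/=.
by rewrite /ball/= sub0r normrN.
Qed.

Lemma lebesgue_rV_bounded n (A : set 'rV[R]_n) (k : R) : (0 < k)%R ->
  measurable A -> A `<=` ball (0%R : 'rV[R]_n) k ->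
  lebesgue_rV R n A <= ((k *+ 2) ^+ n)%:E.
Proof.
move=> k0 mA Ak; rewrite -(lebesgue_rV_ball (0%R : 'rV[R]_n) k0).
by apply: le_measure; rewrite ?inE//; apply: open_measurable_mx; exact: ball_open.
Qed.

Lemma lebesgue_rV_bounded_fin_num n (A : set 'rV[R]_n) (k : R) : (0 < k)%R ->
  measurable A -> A `<=` ball (0%R : 'rV[R]_n) k ->
  lebesgue_rV R n A \is a fin_num.
Proof.
move=> k0 mA Ak; rewrite ge0_fin_numE//.
exact: le_lt_trans (lebesgue_rV_bounded k0 mA Ak) (ltry _).
Qed.

(* The volumes of the sections of [A], [B] and [C], divided by their suprema (by
   the geometric mean of the suprema for [C]), fall under [integral_sumset_ge]. *)
Lemma brunn_minkowski_wgm n (t k : R) (A B C : set 'rV[R]_n) :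
  (0 < t < 1)%R -> (0 < k)%R ->
  measurable A -> measurable B -> measurable C ->
  A `<=` ball (0%R : 'rV[R]_n) k -> B `<=` ball (0%R : 'rV[R]_n) k ->
  (forall x y, A x -> B y -> C (x + y)%R) ->
  (wgm t (fine (lebesgue_rV R n A) / (1 - t) ^+ n)
         (fine (lebesgue_rV R n B) / t ^+ n))%:E <= lebesgue_rV R n C.
Proof.
move=> t01 k0; have /andP[t0 t1] := t01.
have u0 : (0 < 1 - t)%R by rewrite subr_gt0.
elim: n A B C => [|n IH] A B C mA mB mC Ak Bk ABC.
  (* In dimension 0 the measure is the Dirac mass at the only point, so a nonzero left side puts [0]
     in [A] and in [B], hence [0 + 0] in [C]. *)
  rewrite !expr0 !divr1/= diracE !indicE.
  have [/set_mem A0|_] := boolP (0%R \in A); last by rewrite wgm0x// lee_fin.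
  have [/set_mem B0|_] := boolP (0%R \in B); last by rewrite wgmx0// lee_fin.
  by rewrite mem_set ?wgmxx//= -(addr0 0%R); exact: ABC.
pose F (D : set 'rV[R]_n.+1) s :=
  lebesgue_rV R n [set w | D (cons_rV (s, w))].
have mF D : measurable D -> measurable_fun setT (F D).
  exact: measurable_fun_rV_section.
pose M D := sup (range (fine \o F D)).
have Fle D s : measurable D -> D `<=` ball (0%R : 'rV[R]_n.+1) k ->
    F D s <= ((k *+ 2) ^+ n)%:E.
  move=> mD Dk; apply: lebesgue_rV_bounded => //.
    exact: measurable_rV_section.
  by move=> w /= /Dk /(ball_consP k0)[].
have Ffin D s : measurable D -> D `<=` ball (0%R : 'rV[R]_n.+1) k ->
    F D s \is a fin_num.
  move=> mD Dk; rewrite ge0_fin_numE//; exact: le_lt_trans (Fle _ _ mD Dk) (ltry _).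
have hsM D : measurable D -> D `<=` ball (0%R : 'rV[R]_n.+1) k ->
    has_sup (range (fine \o F D)).
  move=> mD Dk; split; first by exists (fine (F D 0%R)), 0%R.
  exists ((k *+ 2) ^+ n)%R => _ [s _ <-] /=.
  by rewrite -lee_fin fineK ?Ffin// Fle.
have FM D s : measurable D -> D `<=` ball (0%R : 'rV[R]_n.+1) k ->
    F D s <= (M D)%:E.
  move=> mD Dk; rewrite -(fineK (Ffin _ s mD Dk)) lee_fin.
  by apply: ub_le_sup; [case: (hsM D mD Dk)|exists s].
have M0 D : measurable D -> D `<=` ball (0%R : 'rV[R]_n.+1) k -> (0 <= M D)%R.
  by move=> mD Dk; rewrite -lee_fin; apply: le_trans (FM _ 0%R mD Dk).
have Meq0 D : measurable D -> D `<=` ball (0%R : 'rV[R]_n.+1) k ->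
    M D = 0%R -> lebesgue_rV R n.+1 D = 0.
  move=> mD Dk MD0; rewrite lebesgue_rVS integral0_eq// => s _.
  by apply/eqP; rewrite eq_le measure_ge0 andbT -[leRHS]/(0%:E) -MD0; exact: FM.
(* If all sections of [A], or all sections of [B], are null, then the geometric mean vanishes. *)
have := M0 _ mA Ak; rewrite le_eqVlt => /predU1P[/esym/(Meq0 _ mA Ak) ->|MA0].
  by rewrite mul0r wgm0x.
have := M0 _ mB Bk; rewrite le_eqVlt => /predU1P[/esym/(Meq0 _ mB Bk) ->|MB0].
  by rewrite mul0r wgmx0.
(* [c] collects the powers of [1 - t] and [t] in the induction hypothesis; [K] is the constant by
   which the section volumes of [C] are normalised. *)
pose c := wgm t ((1 - t) ^- n) (t ^- n).
have c0 : (0 < c)%R by apply: wgm_gt0; rewrite invr_gt0 exprn_gt0.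
pose K := (c * wgm t (M A) (M B))%R.
have K0 : (0 < K)%R by rewrite mulr_gt0// wgm_gt0.
have FE D : measurable D -> forall a : R, (0 <= a)%R ->
    \int[@lebesgue_measure R]_s (a%:E * F D s) = a%:E * lebesgue_rV R n.+1 D.
  by move=> mD a a0; rewrite lebesgue_rVS ge0_integralZl//; exact: mF.
have ltF D l s : (0 < M D)%R -> (l%:E < (M D)^-1%:E * F D s) =
    ((l * M D)%:E < F D s).
  move=> MD0; rewrite -(@lte_pmul2l _ (M D)%:E) ?lte_fin//.
  by rewrite muleA -!EFinM mulfV ?gt_eqF// mul1e mulrC.
have F01 D : measurable D -> D `<=` ball (0%R : 'rV[R]_n.+1) k ->
    (0 < M D)%R -> forall s, 0 <= (M D)^-1%:E * F D s <= 1.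
  move=> mD Dk MD0 s; rewrite mule_ge0 ?lee_fin ?invr_ge0 ?(ltW MD0)//=.
  rewrite -(@lee_pmul2l _ (M D)%:E) ?lte_fin//.
  by rewrite muleA -EFinM mulfV ?gt_eqF// mul1e mule1 FM.
have Fsup D : measurable D -> D `<=` ball (0%R : 'rV[R]_n.+1) k ->
    (0 < M D)%R -> forall l, (l < 1)%R -> exists s, l%:E < (M D)^-1%:E * F D s.
  move=> mD Dk MD0 l l1.
  have e0 : (0 < M D - l * M D)%R by rewrite subr_gt0 gtr_pMl.
  have [_ [s _ <-]] := sup_adherent e0 (hsM _ mD Dk).
  rewrite subKr => ls; exists s.
  by rewrite ltF// -(fineK (Ffin _ s mD Dk)) lte_fin.
have Fk D : measurable D -> D `<=` ball (0%R : 'rV[R]_n.+1) k ->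
    (0 < M D)%R -> forall s, 0 < (M D)^-1%:E * F D s -> (`|s| < k)%R.
  move=> mD Dk MD0 s; rewrite ltF// mul0r => Fs0.
  have [w Dw] : [set w | D (cons_rV (s, w))] !=set0.
    by apply/set0P/eqP => Ds0; move: Fs0; rewrite /F Ds0 measure0 ltxx.
  by have [] := ball_consP k0 (Dk _ Dw).
have := @integral_sumset_ge _ (fun s => (M A)^-1%:E * F A s)
  (fun s => (M B)^-1%:E * F B s) (fun s => K^-1%:E * F C s) k.
rewrite !FE// ?invr_ge0 ?(ltW MA0) ?(ltW MB0) ?(ltW K0)//.
have /fineK <- := lebesgue_rV_bounded_fin_num k0 mA Ak.
have /fineK <- := lebesgue_rV_bounded_fin_num k0 mB Bk.
set al := fine _; set be := fine _ => PL.
have al0 : (0 <= al)%R by rewrite fine_ge0.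
have be0 : (0 <= be)%R by rewrite fine_ge0.
apply: (@le_trans _ _ (K * (al / M A + be / M B))%:E); last first.
  rewrite EFinM -(@lee_pmul2l _ K^-1%:E) ?lte_fin ?invr_gt0//.
  rewrite muleA -(EFinM K^-1 K) mulVf ?gt_eqF// mul1e (mulrC al) (mulrC be).
  rewrite EFinD !EFinM; apply: PL.
  - by apply: measurable_funeM; exact: mF.
  - by apply: measurable_funeM; exact: mF.
  - by apply: measurable_funeM; exact: mF.
  - exact: F01.
  - exact: F01.
  - by move=> s; rewrite mule_ge0// lee_fin invr_ge0 ltW.
  - by move=> s /(Fk _ mA Ak MA0); rewrite ltr_norml => /andP[_ /ltW].
  - by move=> s /(Fk _ mB Bk MB0); rewrite ltr_norml => /andP[/ltW].
  - exact: Fsup.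
  - exact: Fsup.
  move=> l x y l0; rewrite !ltF// => lx ly.
  rewrite -(@lte_pmul2l _ K%:E) ?lte_fin//.
  rewrite muleA -!EFinM mulfV ?gt_eqF// mul1e.
  (* Sections of volumes above [l * M A] and [l * M B] push the mean in the induction hypothesis
     above [l * K], since [wgm] is multiplicative and strictly monotone. *)
  apply: (@lt_le_trans _ _ (wgm t (fine (F A x) / (1 - t) ^+ n)
    (fine (F B y) / t ^+ n))%:E).
    rewrite lte_fin -(@wgmxx _ t _ l0) /K mulrC mulrCA.
    rewrite -wgmM ?ltW// -wgmM ?mulr_ge0 ?invr_ge0 ?exprn_ge0 ?ltW//.
    apply: ltr_wgm => //.
      apply/andP; split; first by rewrite mulr_ge0 ?mulr_ge0 ?invr_ge0 ?exprn_ge0 ?ltW.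
      rewrite mulrC ltr_pM2r ?invr_gt0 ?exprn_gt0//.
      by rewrite -lte_fin fineK ?Ffin.
    apply/andP; split; first by rewrite mulr_ge0 ?mulr_ge0 ?invr_ge0 ?exprn_ge0 ?ltW.
    rewrite mulrC ltr_pM2r ?invr_gt0 ?exprn_gt0//.
    by rewrite -lte_fin fineK ?Ffin.
  apply: IH; try exact: measurable_rV_section.
  - by move=> w /= /Ak /(ball_consP k0)[].
  - by move=> w /= /Bk /(ball_consP k0)[].
  - move=> v w /= Av Bw; have := ABC _ _ Av Bw.
    by have := cons_rV_affine 1 (x, v) (y, w); rewrite !scale1r mul1r/= => ->.
(* AM-GM turns the sum into a geometric mean. Its denominators [1 - t] and [t] raise the exponents
   from [n] to [n.+1], and the suprema cancel against [K]. *)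
rewrite lee_fin; apply: (@le_trans _ _
  (K * wgm t ((al / M A) / (1 - t)) ((be / M B) / t)))%R; last first.
  rewrite ler_pM2l//; apply: wgm_le_add => //; by rewrite divr_ge0// ltW.
suff -> : wgm t (fine al%:E / (1 - t) ^+ n.+1) (fine be%:E / t ^+ n.+1) =
  (K * wgm t (al / M A / (1 - t)) (be / M B / t))%R by [].
rewrite /K /c -!wgmM ?mulr_ge0 ?mulr_ge0 ?invr_ge0 ?exprn_ge0// ?ltW//.
congr (wgm t _ _); rewrite /= exprS; field; rewrite expf_neq0 ?gt_eqF//.
Qed.

End brunn_minkowski.

Section brunn_minkowski_additive.
Context (R : realType).
Local Open Scope ereal_scope.

(** Continuity from below along balls of integer radius. The bound holds for all large radii, so
    that two sets can be cut by the same ball. *)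
Lemma lebesgue_rV_lt_bounded n (a : R) (A : set 'rV[R]_n) : measurable A ->
  a%:E < lebesgue_rV R n A ->
  exists m : nat, forall k : nat, (m <= k)%N ->
    a%:E < lebesgue_rV R n (A `&` ball (0%R : 'rV[R]_n) k%:R).
Proof.
move=> mA aA.
pose F (k : nat) := A `&` ball (0%R : 'rV[R]_n) k%:R.
have mF k : measurable (F k).
  by apply: measurableI => //; apply: open_measurable_mx; exact: ball_open.
have ndF m p : (m <= p)%N -> F m `<=` F p.
  by move=> mp x [Ax mx]; split => //; apply: le_ball mx; rewrite ler_nat.
have FA : \bigcup_k F k = A.
  rewrite -setI_bigcupr; apply/setIidl => x _.
  exists (Num.truncn `|x|).+1 => //.
  by rewrite -ball_normE /= sub0r normrN truncnS_gt.
have cvgF : lebesgue_rV R n \o F @ \oo --> lebesgue_rV R n A.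
  rewrite -[in X in _ --> X]FA; apply: nondecreasing_cvg_mu => //.
    by rewrite FA.
  by move=> m p mp; apply/subsetPset; exact: ndF.
have [m am] : exists m, a%:E < lebesgue_rV R n (F m).
  apply: contrapT => /forallNP Fa; move: aA; apply/negP; rewrite -leNgt.
  rewrite -(cvg_lim _ cvgF)//; apply: lime_le.
    by apply/cvg_ex; exists (lebesgue_rV R n A).
  by apply: nearW => m; rewrite leNgt; apply/negP; exact: Fa.
exists m => k mk; apply: (lt_le_trans am).
by apply: le_measure; rewrite ?inE//; [exact: (mF k)|exact: (ndF m k)].
Qed.

(* The weight [t = b / (a + b)] makes both arguments of the geometric mean at
   least [(a + b) ^+ n]. *)
Lemma brunn_minkowski n (a b : R) (A B C : set 'rV[R]_n) :
  (0 < a)%R -> (0 < b)%R ->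
  measurable A -> measurable B -> measurable C ->
  (a ^+ n)%:E < lebesgue_rV R n A -> (b ^+ n)%:E < lebesgue_rV R n B ->
  (forall x y, A x -> B y -> C (x + y)%R) ->
  ((a + b) ^+ n)%:E <= lebesgue_rV R n C.
Proof.
move=> a0 b0 mA mB mC aA bB ABC; have ab0 : (0 < a + b)%R by exact: addr_gt0.
have [p pA] := lebesgue_rV_lt_bounded mA aA.
have [q qB] := lebesgue_rV_lt_bounded mB bB.
pose k : R := (maxn p q).+1%:R.
have k0 : (0 < k)%R by rewrite ltr0n.
have {pA} : (a ^+ n)%:E < lebesgue_rV R n (A `&` ball (0%R : 'rV[R]_n) k).
  by apply: pA; rewrite (leq_trans (leq_maxl _ q)).
have {qB} : (b ^+ n)%:E < lebesgue_rV R n (B `&` ball (0%R : 'rV[R]_n) k).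
  by apply: qB; rewrite (leq_trans (leq_maxr p _)).
set A' := A `&` _; set B' := B `&` _ => bB' aA'.
have mball : measurable (ball (0%R : 'rV[R]_n) k).
  by apply: open_measurable_mx; exact: ball_open.
have mA' : measurable A' by exact: measurableI.
have mB' : measurable B' by exact: measurableI.
pose t := (b / (a + b))%R.
have tE : (1 - t = a / (a + b))%R by rewrite /t; field; rewrite gt_eqF.
have t01 : (0 < t < 1)%R.
  by rewrite divr_gt0//= ltr_pdivrMr// mul1r ltrDr.
have u0 : (0 < 1 - t)%R by rewrite tE divr_gt0.
apply: le_trans (brunn_minkowski_wgm t01 k0 mA' mB' mC _ _ _); last 3 first.
- exact: subIsetr.
- exact: subIsetr.
- by move=> x y [Ax _] [By _]; exact: ABC.
have abn0 : (0 < (a + b) ^+ n)%R by rewrite exprn_gt0.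
rewrite lee_fin -(@wgmxx _ t _ abn0); apply: ler_wgm => //; rewrite ?(ltW abn0)/=.
  rewrite tE expr_div_n invf_div mulrCA ler_pMr//.
  rewrite ler_pdivlMr ?exprn_gt0// mul1r -lee_fin fineK ?ltW//.
  by apply: (lebesgue_rV_bounded_fin_num k0) => //; exact: subIsetr.
rewrite /t expr_div_n invf_div mulrCA ler_pMr//.
rewrite ler_pdivlMr ?exprn_gt0// mul1r -lee_fin fineK ?ltW//.
by apply: (lebesgue_rV_bounded_fin_num k0) => //; exact: subIsetr.
Qed.

End brunn_minkowski_additive.

(** * Norms and their balls *)

Section norm_theory.
Context (R : realType) (n : nat) (N : 'rV[R]_n -> R) (hN : is_norm N).

Lemma norm0 : N 0 = 0.
Proof. by rewrite -(scale0r 0) (norm_homogeneous hN) normr0 mul0r. Qed.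

Lemma norm_opp x : N (- x) = N x.
Proof. by rewrite -scaleN1r (norm_homogeneous hN) normrN1 mul1r. Qed.

Lemma norm_nonneg x : 0 <= N x.
Proof.
have := norm_triangle hN x (- x); rewrite subrr norm0 norm_opp.
by rewrite -mulr2n pmulrn_lge0.
Qed.

(** Expand a vector in the standard basis; the summand 1 in the constant keeps it positive even for
    an empty basis. *)
Lemma norm_le_sup : exists2 C : R, 0 < C & forall x, N x <= C * `|x|.
Proof.
exists (1 + \sum_j N (delta_mx 0 j)).
  by rewrite ltr_pwDl// sumr_ge0// => j _; exact: norm_nonneg.
move=> x; rewrite {1}(row_sum_delta x).
have sumN (s : seq 'I_n) (u : 'I_n -> 'rV[R]_n) :
    N (\sum_(j <- s) u j) <= \sum_(j <- s) N (u j).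
  elim: s => [|j s IH]; first by rewrite !big_nil norm0.
  by rewrite !big_cons (le_trans (norm_triangle hN _ _))// lerD2l.
apply: (le_trans (sumN _ _)); rewrite mulrDl mul1r mulr_suml.
apply: ler_wpDl => //; apply: ler_sum => j _.
rewrite (norm_homogeneous hN) mulrC ler_wpM2l ?norm_nonneg//.
by rewrite [leRHS]/Num.norm/= mx_normrE; apply: (le_bigmax _ _ (0, j)).
Qed.

Lemma norm_dist_le x y : `|N x - N y| <= N (x - y).
Proof.
have := norm_triangle hN (y - x) x; rewrite subrK -(norm_opp (y - x)) opprB => h1.
have := norm_triangle hN (x - y) y; rewrite subrK => h2.
by rewrite ler_norml; apply/andP; split; lra.
Qed.

Lemma continuous_norm : continuous N.
Proof.
have [C C0 NC] := norm_le_sup.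
move=> x; have Fx := nbhs_filter x.
apply/cvgrPdist_lt => e e0.
have : nbhs x (ball x (e / C)) by apply: nbhsx_ballx; rewrite divr_gt0.
apply: filterS => y; rewrite -ball_normE/= => xy; apply: (le_lt_trans (norm_dist_le _ _)).
by apply: (le_lt_trans (NC _)); rewrite mulrC -ltr_pdivlMr.
Qed.

Lemma measurable_norm : measurable_fun setT N.
Proof.
apply: (measurability _ (RGenOpens.measurableE R)).
move=> _ [_ [a [b ->] <-]]; rewrite setTI; apply: open_measurable_mx.
apply: open_comp; last exact: interval_open.
by move=> v _; exact: continuous_norm.
Qed.

(** By compactness [N] attains its minimum on the unit sphere of the sup norm, where definiteness
    makes it positive; homogeneity extends the bound to all vectors. *)
Lemma norm_ge_sup : exists2 c : R, 0 < c & forall x, c * `|x| <= N x.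
Proof.
pose S := [set x : 'rV[R]_n | `|x| = 1].
(* An empty sphere means that there is no vector but [0]. *)
have [/eqP S0|/set0P S0] := boolP (S == set0).
  exists 1 => // x; have [->|x0] := eqVneq x 0; first by rewrite norm0 normr0 mulr0.
  have /= : S (`|x|^-1 *: x).
    by rewrite /S/= normrZ normfV normr_id mulVf// normr_eq0.
  by rewrite S0.
have cS : compact S.
  apply: bounded_closed_compact.
    exists 1; split => // M M1 x xS; apply: le_trans (ltW M1).
    by rewrite le_eqVlt; apply/orP; left; apply/eqP; exact: xS.
  rewrite (_ : S = (fun x => `|x|) @^-1` [set 1])//; apply: closed_comp.
    by move=> x _; exact: norm_continuous.
  exact: closed_eq.
have cN : {within S, continuous N}.
  by apply: continuous_subspaceT; exact: continuous_norm.
have [x0 /set_mem x0S Nx0] := compact_EVT_min S0 cS cN.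
exists (N x0).
  rewrite lt_neqAle norm_nonneg andbT eq_sym; apply/eqP => /(norm_definite hN) x00.
  by move: x0S; rewrite /S/= x00 normr0 => /esym/eqP; rewrite oner_eq0.
move=> x; have [->|x0'] := eqVneq x 0; first by rewrite norm0 normr0 mulr0.
have xp : 0 < `|x| by rewrite normr_gt0.
rewrite -ler_pdivlMr//; apply: (@le_trans _ _ (N (`|x|^-1 *: x))).
  by apply: Nx0; rewrite inE /S/= normrZ normfV normr_id mulVf// gt_eqF.
by rewrite (norm_homogeneous hN) normfV normr_id mulrC.
Qed.

End norm_theory.

Section norm_balls.
Context (R : realType) (n : nat) (N : 'rV[R]_n -> R) (hN : is_norm N).
Hypothesis n0 : (0 < n)%N.
Local Open Scope ereal_scope.
Notation leb := (lebesgue_rV R n).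

Lemma measurable_norm_lt (r : R) : measurable [set x | (N x < r)%R].
Proof.
have := measurable_norm hN measurableT (measurable_itv `]-oo, r[%R).
by rewrite setTI; congr measurable; apply/seteqP; split=> x /=; rewrite in_itv.
Qed.

Lemma measurable_norm_le (r : R) : measurable [set x | (N x <= r)%R].
Proof.
have := measurable_norm hN measurableT (measurable_itv `]-oo, r]%R).
by rewrite setTI; congr measurable; apply/seteqP; split=> x /=; rewrite in_itv.
Qed.

(** The unit ball of [N] lies between the sup-norm balls of radii [C^-1] and [c^-1]. *)
Lemma norm_ball_volume :
  exists2 v : R, (0 < v)%R & leb [set x | (N x < 1)%R] = v%:E.
Proof.
have [C C0 NC] := norm_le_sup hN; have [c c0 cN] := norm_ge_sup hN.
have mball r : measurable (ball (0%R : 'rV[R]_n) r).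
  by apply: open_measurable_mx; exact: ball_open.
have lo : 0 < leb [set x | (N x < 1)%R].
  apply: (@lt_le_trans _ _ (leb (ball (0%R : 'rV[R]_n) C^-1))).
    by rewrite lebesgue_rV_ball ?invr_gt0// lte_fin exprn_gt0// pmulrn_lgt0// invr_gt0.
  apply: le_measure; rewrite ?inE//; first exact: measurable_norm_lt.
  move=> x; rewrite -ball_normE/= sub0r normrN => xC.
  by apply: (le_lt_trans (NC _)); rewrite mulrC -ltr_pdivlMr// div1r.
have hi : leb [set x | (N x < 1)%R] < +oo.
  apply: (@le_lt_trans _ _ (leb (ball (0%R : 'rV[R]_n) c^-1))); last first.
    by rewrite lebesgue_rV_ball ?invr_gt0// ltry.
  apply: le_measure; rewrite ?inE//; first exact: measurable_norm_lt.
  move=> x /= Nx; rewrite -ball_normE/= sub0r normrN.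
  by rewrite -div1r ltr_pdivlMr// mulrC (le_lt_trans (cN _)).
exists (fine (leb [set x | (N x < 1)%R])); first by rewrite fine_gt0// lo hi.
by rewrite fineK// ge0_fin_numE.
Qed.

Lemma lebesgue_norm_lt (r : R) : (0 <= r)%R ->
  leb [set x | (N x < r)%R] = (r ^+ n)%:E * leb [set x | (N x < 1)%R].
Proof.
rewrite le_eqVlt => /predU1P[<-|r0].
  rewrite expr0n gtn_eqF// mul0e (_ : [set _ | _] = set0) ?measure0//.
  by rewrite -subset0 => x /=; rewrite ltNge norm_nonneg.
rewrite -(@lebesgue_rV_affine _ _ r 0%R)//;
  [|by rewrite gt_eqF|exact: measurable_norm_lt].
rewrite gtr0_norm//; congr (_ * leb _); apply/seteqP; split=> x /=;
  by rewrite addr0 (norm_homogeneous hN) gtr0_norm// gtr_pMr.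
Qed.

(** Taking n-th powers removes the root and the quotient from the radius. The criterion covers sets
    of infinite measure and is convenient for measurability and for volume estimates. *)
Lemma set_starP (A : set 'rV[R]_n) (x : 'rV[R]_n) :
  set_star N A x <-> (N x ^+ n)%:E * leb [set y | (N y < 1)%R] < leb A.
Proof.
rewrite /set_star/=; have [v v0 ->] := norm_ball_volume.
have nV0 : (n%:R^-1 != 0 :> R)%R by rewrite invr_eq0 pnatr_eq0 gtn_eqF.
have Nx0 : (0 <= N x)%R by exact: norm_nonneg.
rewrite inver gt_eqF//; have : 0 <= leb A by exact: measure_ge0.
case: (leb A) => [a| |]//; last first.
  by rewrite gt0_mulye ?lte_fin ?invr_gt0// poweRyr// -EFinM !ltry.
rewrite lee_fin => a0; rewrite -!EFinM poweR_EFin !lte_fin.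
rewrite -(ltr_pdivlMr _ _ v0).
have av0 : (0 <= a / v)%R by rewrite divr_ge0// ltW.
have n1 : (0 <= n%:R^-1 :> R)%R by rewrite invr_ge0.
have NxE : N x = ((N x ^+ n) `^ n%:R^-1)%R.
  by rewrite -powR_mulrn// -powRrM mulfV ?powRr1// pnatr_eq0 gtn_eqF.
split=> H.
  rewrite ltNge; apply/negP => h; move: H; rewrite NxE ltNge => /negP; apply.
  by apply: ge0_ler_powR; rewrite ?nnegrE ?exprn_ge0.
rewrite NxE; apply: gt0_ltr_powR; rewrite ?nnegrE ?exprn_ge0//.
by rewrite lt_neqAle n1 eq_sym nV0.
Qed.

Lemma measure_set_star (A : set 'rV[R]_n) : leb A < +oo ->
  exists2 r : R, (0 <= r)%R &
    set_star N A = [set x | (N x < r)%R] /\ leb (set_star N A) = leb A.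
Proof.
move=> Aoo; have [v v0 vE] := norm_ball_volume.
have /fineK AE : leb A \is a fin_num by rewrite ge0_fin_numE.
set a := fine (leb A) in AE; have a0 : (0 <= a)%R by rewrite fine_ge0.
pose r := ((a / v) `^ n%:R^-1)%R.
have r0 : (0 <= r)%R by exact: powR_ge0.
have sE : set_star N A = [set x | (N x < r)%R].
  apply/seteqP; split=> x; rewrite /set_star/= vE inver gt_eqF// -AE -EFinM;
  by rewrite poweR_EFin lte_fin.
exists r => //; split => //; rewrite sE lebesgue_norm_lt// vE.
rewrite /r -powR_mulrn ?powR_ge0// -powRrM mulVf ?pnatr_eq0 ?gtn_eqF//.
rewrite powRr1 ?divr_ge0//; last exact: ltW.
by rewrite -EFinM divfK ?gt_eqF.
Qed.

End norm_balls.

(** * Superlevel sets of a density *)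

Section null_sets.
Local Open Scope ereal_scope.
Context d (T : measurableType d) (R : realType)
  (mu : {measure set T -> \bar R}).

Lemma ge0_integral_eq0_measure (D : set T) (f : T -> \bar R) :
  measurable D -> measurable_fun setT f -> (forall x, 0 <= f x) ->
  \int[mu]_(x in D) f x = 0 -> mu (D `&` [set x | 0 < f x]) = 0.
Proof.
move=> mD mf f0 intf0; apply: measure_negligible.
  by apply: emeasurable_fun_o_infty => //; exact: measurable_funTS.
have : ae_eq mu D f (cst 0).
  apply/ae_eq_integral_abs => //; first exact: measurable_funTS.
  by rewrite -[RHS]intf0; apply: eq_integral => x _; rewrite gee0_abs.
apply: negligibleS => x [Dx /= fx] /(_ Dx)/= fx0.
by move: fx; rewrite fx0 ltxx.
Qed.

(** [f - k] has integral at most 0 over [A] although it is positive there; finiteness of [mu A]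
    permits the subtraction. The maximum with 0 makes [g] nonnegative off [A] as well. *)
Lemma measure_eq0_integral_le (A : set T) (f : T -> R) (k : R) :
  measurable A -> measurable_fun setT f -> (0 <= k)%R -> mu A < +oo ->
  (forall x, A x -> (k < f x)%R) ->
  \int[mu]_(x in A) (f x)%:E <= k%:E * mu A -> mu A = 0.
Proof.
move=> mA mf k0 Aoo kf intf.
pose g x := (Num.max (f x - k) 0)%:E.
have mg : measurable_fun setT g.
  by apply/measurable_EFinP; apply: measurable_maxr => //; exact: measurable_funB.
have g0 x : 0 <= g x by rewrite lee_fin le_max lexx orbT.
have fE : \int[mu]_(x in A) (f x)%:E = \int[mu]_(x in A) g x + k%:E * mu A.
  rewrite -integral_cst// -ge0_integralD//; last exact: measurable_funTS.
  apply: eq_integral => x /set_mem Ax; rewrite /g/= max_l; last first.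
    by rewrite subr_ge0 ltW// kf.
  by rewrite -EFinD subrK.
have kA : k%:E * mu A \is a fin_num.
  by rewrite fin_numM// ge0_fin_numE.
have g_int0 : \int[mu]_(x in A) g x = 0.
  apply/eqP; rewrite eq_le integral_ge0 ?andbT//.
  by rewrite -(leeD2rE _ _ kA) add0e -fE.
have := ge0_integral_eq0_measure mA mg g0 g_int0.
by rewrite setIidl// => x Ax; rewrite /g/= lte_fin lt_max subr_gt0 kf.
Qed.

End null_sets.

Section translation.
Local Open Scope ereal_scope.
Context (R : realType) (n : nat).
Notation leb := (lebesgue_rV R n).

Lemma image_shift (u : 'rV[R]_n) (A : set 'rV[R]_n) :
  [set (x + u)%R | x in A] = [set x | A (x - u)%R].
Proof.
apply/seteqP; split=> [_ [x Ax <-]|x Ax] /=; first by rewrite addrK.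
by exists (x - u)%R; rewrite ?subrK.
Qed.

Lemma measurable_rV_shift (u : 'rV[R]_n) (A : set 'rV[R]_n) : measurable A ->
  measurable [set x | A (x + u)%R].
Proof.
move=> mA; have := @measurable_preimage_affine _ _ 1 u _ mA.
by under eq_set do rewrite scale1r.
Qed.

Lemma ge0_integral_rV_shift (u : 'rV[R]_n) (A : set 'rV[R]_n)
    (f : 'rV[R]_n -> \bar R) :
  measurable A -> measurable_fun setT f -> (forall x, 0 <= f x) ->
  \int[leb]_(x in [set (x + u)%R | x in A]) f x =
  \int[leb]_(x in A) f (x + u)%R.
Proof.
move=> mA mf f0; rewrite image_shift integral_mkcond [RHS]integral_mkcond.
have mA' : measurable [set x | A (x - u)%R] by exact: measurable_rV_shift.
rewrite -(@ge0_integral_scaling _ _ _ leb (fun x => x + u)%R 1); last 5 first.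
- by [].
- have := @measurable_rV_affine R n 1 u.
  by congr measurable_fun; apply/funext => x; rewrite scale1r.
- by move=> B mB; rewrite mul1e; exact: lebesgue_rV_translate.
- by apply/(measurable_restrictT _ mA'); exact: measurable_funTS.
- by move=> x; exact: erestrict_ge0.
rewrite mul1e; apply: eq_integral => x _; rewrite !patchE; congr (if _ then _ else _).
by apply/idP/idP => /set_mem/=; rewrite ?addrK => Ax; rewrite inE/= ?addrK.
Qed.

End translation.

Section level_sets.
Local Open Scope ereal_scope.
Context (R : realType) (n : nat) (N : 'rV[R]_n -> R) (hN : is_norm N).
Hypothesis n0 : (0 < n)%N.
Context (mu : set 'rV[R]_n -> \bar R) (f : 'rV[R]_n -> R).
Hypothesis fmu : has_density mu (EFin \o f).
Notation leb := (lebesgue_rV R n).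
Notation superlevel l := [set y | (l < f y)%R].

Let mf : measurable_fun setT f.
Proof. by apply/measurable_EFinP; case: fmu. Qed.

Let f0 x : (0 <= f x)%R. Proof. by rewrite -lee_fin; case: fmu => _ + _; exact. Qed.

Lemma measurable_superlevel l : measurable (superlevel l).
Proof.
have := mf measurableT (measurable_itv `]l, +oo[%R).
by rewrite setTI; congr measurable; apply/seteqP; split=> x /=; rewrite in_itv/= andbT.
Qed.

(** Markov's inequality. *)
Lemma lebesgue_superlevel_lty l : mu setT < +oo -> (0 < l)%R ->
  leb (superlevel l) < +oo.
Proof.
move=> muoo l0; rewrite ltey; apply/eqP => El.
have : l%:E * leb (superlevel l) <= mu setT.
  have [_ _ muE] := fmu; rewrite muE// -integral_cst//; last exact: measurable_superlevel.
  apply: (@le_trans _ _ (\int[leb]_(x in superlevel l) (f x)%:E)).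
    apply: ge0_le_integral => //.
    - exact: measurable_superlevel.
    - by move=> x _; rewrite lee_fin ltW.
    - by apply/measurable_EFinP; exact: measurable_funTS.
    - by move=> x /= lx; rewrite lee_fin ltW.
  apply: ge0_subset_integral => //.
  - exact: measurable_superlevel.
  - by apply/measurable_EFinP.
  - by move=> x _; rewrite lee_fin.
by rewrite El gt0_muley ?lte_fin// leNgt muoo.
Qed.

(** On the exceptional set [f] exceeds [expR eps * l], while its translate by [u] is at most [l].
    The privacy condition bounds the mass of this set by [expR eps * l] times its volume, which
    forces the volume to be 0. *)
Lemma superlevel_shift_null (Delta eps l : R) (u : 'rV[R]_n) :
  mu setT < +oo -> eps_DP N Delta eps mu -> (N u <= Delta)%R -> (0 < l)%R ->
  leb (superlevel (expR eps * l) `&` [set x | ~ superlevel l (x + u)%R]) = 0.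
Proof.
move=> muoo DP uD l0; set A := _ `&` _.
have el0 : (0 < expR eps * l)%R by rewrite mulr_gt0// expR_gt0.
have mA : measurable A.
  apply: measurableI; first exact: measurable_superlevel.
  rewrite (_ : [set _ | _] = ~` [set x | superlevel l (x + u)%R])//.
  by apply: measurableC; apply: measurable_rV_shift; exact: measurable_superlevel.
have Aoo : leb A < +oo.
  apply: le_lt_trans (lebesgue_superlevel_lty muoo el0).
  by apply: le_measure; rewrite ?inE//; [exact: measurable_superlevel|exact: subIsetl].
apply: (measure_eq0_integral_le mA mf (ltW el0) Aoo); first by move=> x [].
have [_ _ muE] := fmu; rewrite -(muE _ mA); apply: (le_trans (DP _ _ mA uD)).
rewrite EFinM -muleA lee_pmul2l ?lte_fin ?expR_gt0//.
rewrite muE; last by rewrite image_shift; exact: measurable_rV_shift.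
rewrite ge0_integral_rV_shift//; last by apply/measurable_EFinP.
rewrite -integral_cst//; apply: ge0_le_integral => //.
- by move=> x _; rewrite lee_fin.
- apply: measurable_funTS; apply/measurable_EFinP; apply: measurableT_comp => //.
  have := @measurable_rV_affine R n 1 u.
  by congr measurable_fun; apply/funext => x; rewrite scale1r.
- by move=> x [_ /negP]; rewrite lee_fin -leNgt.
Qed.

End level_sets.

Section essential_part.
Local Open Scope ereal_scope.
Context (R : realType) (n : nat).
Notation leb := (lebesgue_rV R n).

(* Lindelof: discard the countably many rational balls that meet [A] in a null
   set. *)
Lemma essential_part (A : set 'rV[R]_n) : measurable A ->
  exists A1 : set 'rV[R]_n, [/\ measurable A1, leb A1 = leb A &
    forall x U, A1 x -> open U -> U x -> 0 < leb (A `&` U)].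
Proof.
move=> mA.
pose b (c : 'rV[rat]_n * nat) :=
  A `&` ball (map_mx ratr c.1 : 'rV[R]_n) c.2.+1%:R^-1.
have mb c : measurable (b c).
  by apply: measurableI => //; apply: open_measurable_mx; exact: ball_open.
(* [Z] lists the null pieces by their codes; all other codes contribute the empty set. *)
pose Z k := if unpickle k is Some c then
  (if leb (b c) == 0 then b c else set0) else set0.
have mZ k : measurable (Z k).
  by rewrite /Z; case: unpickle => // c; case: ifPn.
have Z0 k : leb (Z k) = 0.
  rewrite /Z; case: unpickle => [c|]; rewrite ?measure0//.
  by case: ifPn => [/eqP|_]; rewrite ?measure0.
have ZA k : Z k `<=` A.
  rewrite /Z; case: unpickle => [c|]; last exact: sub0set.
  by case: ifPn => _; [exact: subIsetl|exact: sub0set].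
have mUZ : measurable (\bigcup_k Z k) by exact: bigcupT_measurable.
have UZ0 : leb (\bigcup_k Z k) = 0.
  apply: measure_negligible => //; apply: negligible_bigcup => k.
  by apply/(negligibleP _ (mZ k)); exact: Z0.
exists (A `\` \bigcup_k Z k); split; first exact: measurableD.
  have UZA : \bigcup_k Z k `<=` A by move=> x [k _] Zx; apply: (ZA k).
  rewrite -[in RHS](setDUK UZA) measureU//; [|exact: measurableD|].
    by rewrite [X in X + _]UZ0 add0e.
  by rewrite -subset0 => x [? []].
move=> x U [Ax Zx] oU; rewrite {1}(open_rV_ratball oU) => -[c cU xc].
rewrite lt_neqAle measure_ge0 andbT eq_sym; apply/eqP => AU0.
apply: Zx; exists (pickle c) => //; rewrite /Z pickleK ifT//.
rewrite eq_le measure_ge0 andbT -[leRHS]AU0; apply: le_measure; rewrite ?inE//.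
  by apply: measurableI => //; exact: open_measurable_mx.
exact: setIS.
Qed.

End essential_part.

Section superlevel_growth.
Local Open Scope ereal_scope.
Context (R : realType) (n : nat) (N : 'rV[R]_n -> R) (hN : is_norm N).
Hypothesis n0 : (0 < n)%N.
Notation leb := (lebesgue_rV R n).

Lemma measurable_norm_dist (r : R) :
  measurable [set p : 'rV[R]_n * 'rV[R]_n | (N (p.1 - p.2) < r)%R].
Proof.
have := measurableT_comp (measurable_norm hN)
  (measurable_rVB (@measurable_fst _ _ 'rV[R]_n 'rV[R]_n)
    (@measurable_snd _ _ 'rV[R]_n 'rV[R]_n)).
move=> /(_ measurableT _ (measurable_itv `]-oo, r[%R)).
by rewrite setTI; congr measurable; apply/seteqP; split=> x /=; rewrite in_itv.
Qed.

Lemma measurable_rVD_pair (E : set 'rV[R]_n) : measurable E ->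
  measurable [set p : 'rV[R]_n * 'rV[R]_n | E (p.1 + p.2)%R].
Proof.
move=> mE; have mN : measurable_fun setT (fun p : 'rV[R]_n * 'rV[R]_n => - p.2)%R.
  have mO : measurable_fun setT (fun x : 'rV[R]_n => - x)%R.
    have := @measurable_rV_affine R n (-1) 0.
    by congr measurable_fun; apply/funext => x; rewrite scaleN1r addr0.
  by apply: (measurableT_comp mO); exact: measurable_snd.
have := measurable_rVB (@measurable_fst _ _ 'rV[R]_n 'rV[R]_n) mN.
move=> /(_ measurableT _ mE); rewrite setTI; congr measurable.
by apply/seteqP; split=> p /=; rewrite opprK.
Qed.

(** The set on the left is an essential version of the sum of [A] and the open ball of radius
    [Delta]. By Tonelli its part outside [E] is null: for each [u] in the ball, almost no [x] in [A]
    has [x + u] outside [E]. *)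
Lemma essential_sumset_sub (A E : set 'rV[R]_n) (Delta : R) :
  measurable A -> measurable E ->
  (forall u, (N u < Delta)%R -> leb (A `&` [set x | ~ E (x + u)%R]) = 0) ->
  leb [set y | 0 < leb (A `&` [set x | (N (y - x) < Delta)%R])] <= leb E.
Proof.
move=> mA mE AE0; set S := [set y | _].
have mg : measurable_fun setT
    (fun y : 'rV[R]_n => leb (A `&` [set x : 'rV[R]_n | (N (y - x) < Delta)%R])).
  exact: (measurable_fun_section_fst leb (measurable_norm_dist Delta)).
have mS : measurable S.
  by rewrite -[X in measurable X]setTI; exact: emeasurable_fun_o_infty.
have mCE : measurable (~` E) by exact: measurableC.
suff SE0 : leb (~` E `&` S) = 0.
  apply: (@le_trans _ _ (leb (E `|` (~` E `&` S)))).
    apply: le_measure; rewrite ?inE//.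
      by apply: measurableU => //; exact: measurableI.
    by move=> y Sy; have [Ey|Ey] := pselect (E y); [left|right].
  apply: (le_trans (measureU2 _ _ _)) => //; first exact: measurableI.
  by rewrite [X in _ + X]SE0 adde0.
apply: ge0_integral_eq0_measure => //.
rewrite (sections_tonelli leb leb (measurable_norm_dist Delta))//.
(* Substitute [y = x + u] for fixed [x]; a second exchange then puts the integral over [u]
   outside. *)
transitivity (\int[leb]_(x in A)
    leb ([set u | (N u < Delta)%R] `&` [set u | (~` E) (x + u)%R])).
  apply: eq_integral => x _; rewrite -[LHS](lebesgue_rV_translate x); last first.
    apply: measurableI => //.
    exact: (measurable_rV_shift (- x) (measurable_norm_lt hN Delta)).
  congr (leb _); apply/seteqP; split=> u /=; rewrite addrK addrC; tauto.
rewrite (sections_tonelli leb leb (measurable_rVD_pair mCE))//; last first.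
  exact: measurable_norm_lt.
by rewrite integral0_eq// => u /= uD; exact: AE0.
Qed.

End superlevel_growth.

Section star_growth.
Local Open Scope ereal_scope.
Context (R : realType) (n : nat) (N : 'rV[R]_n -> R) (hN : is_norm N).
Hypothesis n0 : (0 < n)%N.
Context (mu : set 'rV[R]_n -> \bar R) (f : 'rV[R]_n -> R).
Hypothesis fmu : has_density mu (EFin \o f).
Hypothesis muoo : mu setT < +oo.
Notation leb := (lebesgue_rV R n).
Notation superlevel l := [set y | (l < f y)%R].

(** The essential part of [A] plus the open ball of radius [Delta] lies in [S], whose volume is at
    most that of [E]. Brunn-Minkowski with radii just below [r] and [Delta] shows that [E] has
    larger volume than the ball of radius [N (x + u)]. *)
Lemma superlevel_star_growth (Delta eps l : R) (x u : 'rV[R]_n) :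
  eps_DP N Delta eps mu -> (0 < Delta)%R -> (0 < l)%R -> (N u <= Delta)%R ->
  set_star N (superlevel (expR eps * l)) x -> set_star N (superlevel l) (x + u)%R.
Proof.
move=> DP D0 l0 uD; set A := superlevel (expR eps * l); set E := superlevel l.
have el0 : (0 < expR eps * l)%R by rewrite mulr_gt0// expR_gt0.
have mA : measurable A by exact: (measurable_superlevel fmu).
have mE : measurable E by exact: (measurable_superlevel fmu).
have Aoo : leb A < +oo by exact: (lebesgue_superlevel_lty fmu).
have [v v0 vE] := norm_ball_volume hN.
have [r r0 [starA lebA]] := measure_set_star hN n0 Aoo.
rewrite starA/= => xr; apply/(set_starP hN n0); rewrite vE.
have {}lebA : leb A = (r ^+ n * v)%:E.
  by rewrite -lebA starA lebesgue_norm_lt// vE -EFinM.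
have [A1 [mA1 A1A A1U]] := essential_part mA.
pose S := [set y : 'rV[R]_n |
  0 < leb (A `&` [set z : 'rV[R]_n | (N (y - z) < Delta)%R])].
have SE : leb S <= leb E.
  apply: (essential_sumset_sub hN mA mE) => t /ltW tD.
  exact: (superlevel_shift_null fmu muoo DP).
apply: lt_le_trans SE.
have mS : measurable S.
  rewrite -[X in measurable X]setTI; apply: emeasurable_fun_o_infty => //.
  exact: (measurable_fun_section_fst leb (measurable_norm_dist hN Delta)).
(* The open ball of radius [Delta] around [y + z] is a neighbourhood of [y], so it meets [A] in
   positive measure. *)
have A1S y z : A1 y -> (N z < Delta)%R -> S (y + z)%R.
  move=> A1y zD; apply: (A1U y [set t | (N (y + z - t) < Delta)%R]) => //=.
    rewrite (_ : [set t | _] = (fun t : 'rV[R]_n => N (y + z - t)) @^-1`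
      [set s | (s < Delta)%R])//; apply: open_comp.
      move=> t _; apply: continuous_comp; last exact: continuous_norm.
      by apply: continuousB; [exact: cst_continuous|move=> ?; exact: cvg_id].
    exact: open_lt.
  by rewrite addrAC subrr add0r.
(* With this n-th root of the unit ball's volume, [(a * w) ^+ n] is the volume of the ball of radius
   [a]. *)
pose w := (v `^ n%:R^-1)%R.
have w0 : (0 < w)%R by rewrite powR_gt0.
have wn : (w ^+ n = v)%R.
  rewrite -powR_mulrn ?(ltW w0)// /w -powRrM mulVf ?pnatr_eq0 ?gtn_eqF//.
  by rewrite powRr1// ltW.
have Nx0 := norm_nonneg hN x.
(* Half the gap between [N x] and [r] goes into [a], and [b] falls short of [Delta] by at most
   [e / 2], whence [N (x + u) < a + b]. Brunn-Minkowski needs the strict bounds [a < r] and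
   [b < Delta]; the minimum with [Delta / 2] keeps [b] positive. *)
pose e := ((r - N x) / 2)%R.
have e0 : (0 < e)%R by rewrite divr_gt0// subr_gt0.
pose a := (N x + e)%R; pose b := (Delta - Num.min (e / 2) (Delta / 2))%R.
have [be bD] : (Delta - e / 2 <= b)%R /\ (0 < b < Delta)%R.
  by rewrite /b minEle; case: ifPn => h; split; try (apply/andP; split); lra.
have [b0 bltD] := andP bD.
have a0 : (0 < a)%R by rewrite /a ltr_wpDl.
have ar : (a < r)%R by rewrite /a /e; lra.
apply: (@lt_le_trans _ _ ((a * w + b * w) ^+ n)%:E).
  rewrite -EFinM lte_fin -mulrDl exprMn wn ltr_pM2r// ltrXn2r -?lt0n//.
    exact: norm_nonneg.
  rewrite (le_lt_trans (norm_triangle hN _ _))// /a; lra.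
apply: (brunn_minkowski _ _ mA1 (measurable_norm_lt hN Delta) mS) => //.
- by rewrite mulr_gt0.
- by rewrite mulr_gt0.
- rewrite A1A lebA lte_fin exprMn wn ltr_pM2r//.
  by rewrite ltrXn2r -?lt0n// ltW.
- rewrite lebesgue_norm_lt// ?ltW// vE -EFinM lte_fin exprMn wn ltr_pM2r//.
  by rewrite ltrXn2r -?lt0n// ltW.
Qed.

End star_growth.

(** * The rearranged density *)

Section star_density.
Local Open Scope ereal_scope.
Context (R : realType) (n : nat) (N : 'rV[R]_n -> R) (hN : is_norm N).
Hypothesis n0 : (0 < n)%N.
Context (mu : set 'rV[R]_n -> \bar R) (f : 'rV[R]_n -> R).
Hypothesis fmu : has_density mu (EFin \o f).
Hypothesis muoo : mu setT < +oo.
Notation leb := (lebesgue_rV R n).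
Notation superlevel l := [set y | (l < f y)%R].
Notation Rpos := (`]0%R, +oo[%classic : set R).

Let mf : measurable_fun setT (EFin \o f). Proof. by case: fmu. Qed.

Let f0 x : 0 <= (EFin \o f) x. Proof. by case: fmu => _ + _; exact. Qed.

(** By [set_starP] membership is a strict inequality between a measurable function of the point and
    the volume of a section of the hypograph, which is measurable in the level. *)
Lemma measurable_star_superlevel : measurable
  [set p : 'rV[R]_n * measurableTypeR R | set_star N (superlevel p.2) p.1].
Proof.
have [v v0 vE] := norm_ball_volume hN.
rewrite [X in measurable X](_ : _ = setT `&`
  [set p : 'rV[R]_n * measurableTypeR R |
    (N p.1 ^+ n * v)%:E < leb (superlevel p.2)]); last first.
  rewrite setTI; apply/seteqP; split=> p /=.
    by move=> /(set_starP hN n0); rewrite vE.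
  by move=> ?; apply/(set_starP hN n0); rewrite vE.
apply: (@measurable_lte _ _ R setT measurableT).
  apply/measurable_EFinP; apply: measurable_funM => //.
  apply: measurable_funX.
  by apply: (measurableT_comp (measurable_norm hN)); exact: measurable_fst.
apply: (@measurableT_comp _ _ _ _ _ _
  (fun l : measurableTypeR R => leb (superlevel l))); last exact: measurable_snd.
have := measurable_fun_ysection leb (measurable_hypograph mf).
by congr measurable_fun; apply/funext => l /=; rewrite ysectionE.
Qed.

Let measurable_star_section x :
  measurable [set l : measurableTypeR R | set_star N (superlevel l) x].
Proof.
by have := measurable_xsection x measurable_star_superlevel; rewrite xsectionE.
Qed.

(** The level 0 is a null set of levels; without it only superlevel sets of finite measure
    remain. *)
Lemma fun_starE x : fun_star N f x =
  @lebesgue_measure R (Rpos `&` [set l | set_star N (superlevel l) x]).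
Proof.
rewrite /fun_star.
transitivity (\int[@lebesgue_measure R]_(l in `[0%R, +oo[)
    (\1_[set l : R | set_star N (superlevel l) x] l)%:E).
  by apply: eq_integral => l _; rewrite !indicE.
rewrite -integral_itv_obnd_cbnd; last first.
  apply/measurable_EFinP; apply: measurable_funTS.
  by apply: measurable_indic; exact: measurable_star_section.
by rewrite integral_indic// setIC.
Qed.

Lemma measurable_fun_star : measurable_fun setT (fun_star N f).
Proof.
have := measurable_fun_section_fst (@lebesgue_measure R) measurable_star_superlevel
  (measurable_itv `]0%R, +oo[).
by congr measurable_fun; apply/funext => x; rewrite fun_starE.
Qed.

Lemma fun_star_ge0 x : 0 <= fun_star N f x.
Proof. by rewrite fun_starE. Qed.

Lemma integral_fun_star (K : set 'rV[R]_n) : measurable K ->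
  \int[leb]_(x in K) fun_star N f x =
  \int[lebesgue_measure]_(l in `]0%R, +oo[) leb (K `&` set_star N (superlevel l)).
Proof.
move=> mK; have := sections_tonelli leb (@lebesgue_measure R)
  measurable_star_superlevel mK (measurable_itv `]0%R, +oo[).
move=> <-; apply: eq_integral => x _; exact: fun_starE.
Qed.

Lemma integral_density (K : set 'rV[R]_n) : measurable K ->
  mu K = \int[lebesgue_measure]_(l in `]0%R, +oo[) leb (K `&` superlevel l).
Proof.
move=> mK; have [_ _ ->//] := fmu; exact: (ge0_integral_layer_cake leb mf f0 mK).
Qed.

Lemma integral_fun_starT : \int[leb]_x fun_star N f x = mu setT.
Proof.
rewrite integral_fun_star// integral_density//; apply: eq_integral => l.
rewrite inE/= in_itv/= andbT => l0; rewrite !setTI.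
have [r r0 [_ ->]//] := measure_set_star hN n0 (lebesgue_superlevel_lty fmu muoo l0).
Qed.

(* The two centred balls [set_star N _] and [N x <= c] are nested. *)
Lemma norm_ball_superlevel_star (c l : R) : (0 < l)%R ->
  leb ([set x | (N x <= c)%R] `&` superlevel l) <=
  leb ([set x | (N x <= c)%R] `&` set_star N (superlevel l)).
Proof.
move=> l0; have mK := measurable_norm_le hN c.
have mE := measurable_superlevel fmu l.
have [r r0 [starE lebE]] :=
  measure_set_star hN n0 (lebesgue_superlevel_lty fmu muoo l0).
have ms := measurable_norm_lt hN r.
have [rc|cr] := leP r c.
  rewrite (setIidr (_ : set_star N _ `<=` _)) ?lebE; last first.
    by rewrite starE => x /= xr; rewrite (le_trans (ltW xr)).
  by apply: le_measure; rewrite ?inE//; exact: measurableI.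
rewrite (setIidl (_ : _ `<=` set_star N _)); last first.
  by rewrite starE => x /= xc; rewrite (le_lt_trans xc).
by apply: le_measure; rewrite ?inE//; exact: measurableI.
Qed.

Lemma norm_ball_density_star (c : R) :
  mu [set x | (N x <= c)%R] <= \int[leb]_(x in [set x | (N x <= c)%R]) fun_star N f x.
Proof.
have mK := measurable_norm_le hN c.
rewrite integral_density// integral_fun_star//; apply: ge0_le_integral => //.
- apply: measurable_funTS.
  exact: (measurable_fun_section_snd leb (measurable_hypograph mf) mK).
- apply: measurable_funTS.
  exact: (measurable_fun_section_snd leb measurable_star_superlevel mK).
- by move=> l /=; rewrite in_itv/= andbT; exact: norm_ball_superlevel_star.
Qed.

(** If [expR eps * l] is a level counted at [x], then [l] is one counted at [x + u]; dividing all
    levels by [expR eps] divides the length by the same factor. *)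
Lemma fun_star_shift (Delta eps : R) (x u : 'rV[R]_n) :
  eps_DP N Delta eps mu -> (0 < Delta)%R -> (N u <= Delta)%R ->
  fun_star N f x <= (expR eps)%:E * fun_star N f (x + u)%R.
Proof.
move=> DP D0 uD; rewrite !fun_starE.
have e0 := expR_gt0 eps.
have mI y : measurable (Rpos `&` [set l | set_star N (superlevel l) y]).
  by apply: measurableI => //; exact: measurable_star_section.
rewrite -(@lebesgue_measure_affine _ (expR eps) 0 _ _ (mI x)) ?gt_eqF//.
rewrite gtr0_norm// lee_pmul2l ?lte_fin//.
apply: le_measure; rewrite ?inE//.
  have /(_ measurableT _ (mI x)) :
      measurable_fun setT (fun l : R => (expR eps * l + 0)%R).
    by apply: measurable_funD => //; exact: measurable_funM.
  by rewrite setTI.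
  exact: (mI (x + u)%R).
move=> l /=; rewrite addr0 !in_itv/= !andbT pmulr_rgt0// => -[l0 xl].
split => //.
exact: (superlevel_star_growth hN n0 fmu muoo DP).
Qed.

Lemma eps_DP_star (Delta eps : R) (nu : set 'rV[R]_n -> \bar R) :
  eps_DP N Delta eps mu -> (0 < Delta)%R -> has_density nu (fun_star N f) ->
  eps_DP N Delta eps nu.
Proof.
move=> DP D0 [mg g0 nuE] A u mA uD.
have mAu : measurable [set (z + u)%R | z in A].
  by rewrite image_shift; exact: measurable_rV_shift.
rewrite !nuE// ge0_integral_rV_shift//.
have mgu : measurable_fun A (fun x => fun_star N f (x + u)%R).
  apply: measurable_funTS; apply: measurableT_comp => //.
  have := @measurable_rV_affine R n 1 u.
  by congr measurable_fun; apply/funext => x; rewrite scale1r.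
rewrite -ge0_integralZl// ?lee_fin ?expR_ge0//.
apply: ge0_le_integral => //.
- exact: measurable_funTS.
- exact: measurable_funeM.
- by move=> x _; exact: (@fun_star_shift Delta).
Qed.

End star_density.

(** * Existence of the densities *)

Section density_measure.
Local Open Scope ereal_scope.
Context d (T : measurableType d) (R : realType)
  (m : {measure set T -> \bar R}) (g : T -> \bar R).

Definition density_measure (A : set T) : \bar R := \int[m]_(x in A) g x.

Hypotheses (mg : measurable_fun setT g) (g0 : forall x, 0 <= g x).

Let density_measure0 : density_measure set0 = 0.
Proof. exact: integral_set0. Qed.

Let density_measure_ge0 A : 0 <= density_measure A.
Proof. exact: integral_ge0. Qed.

Let density_measure_sigma_additive : semi_sigma_additive density_measure.
Proof.
move=> /= F mF tF mUF; rewrite /density_measure; apply: cvg_toP.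
  apply: ereal_nondecreasing_is_cvgn => p q pq.
  by apply: lee_sum_nneg_natr => // k _ _; exact: integral_ge0.
by rewrite ge0_integral_bigcup//; exact: measurable_funTS.
Qed.

HB.instance Definition _ := isMeasure.Build _ _ _ density_measure
  density_measure0 density_measure_ge0 density_measure_sigma_additive.

Hypothesis g1 : \int[m]_x g x = 1.

HB.instance Definition _ :=
  @Measure_isProbability.Build _ _ R density_measure g1.

Definition density_probability : probability T R := density_measure.

End density_measure.

Section DP_density.
Local Open Scope ereal_scope.
Context (R : realType) (n : nat) (N : 'rV[R]_n -> R) (hN : is_norm N).
Hypothesis n0 : (0 < n)%N.
Notation leb := (lebesgue_rV R n).

(* By Fubini almost every translate of a null set has measure 0, and the
   privacy condition compares the set with its small translates. *)
Lemma DP_null_dominates (Delta eps : R)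
    (mu : {finite_measure set 'rV[R]_n -> \bar R}) :
  (0 < Delta)%R -> eps_DP N Delta eps mu -> mu `<< leb.
Proof.
move=> D0 DP B nullB A mA AB; have A0 : leb A = 0 by exact: nullB.
have mD := measurable_norm_lt hN Delta; set D := [set _ | _] in mD.
have mAB : measurable [set p : 'rV[R]_n * 'rV[R]_n | A (p.1 - p.2)%R].
  have /(_ measurableT _ mA) := measurable_rVB
    (@measurable_fst _ _ 'rV[R]_n 'rV[R]_n) (@measurable_snd _ _ 'rV[R]_n 'rV[R]_n).
  by rewrite setTI.
have : leb (D `&` [set u | 0 < mu (setT `&` [set x | A (x - u)%R])]) = 0.
  apply: ge0_integral_eq0_measure => //.
    exact: (measurable_fun_section_snd mu mAB).
  (* After the exchange the inner sets lie in reflected translates of [A], which are null. *)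
  rewrite -(sections_tonelli mu leb mAB)// integral0_eq// => x _.
  apply/eqP; rewrite eq_le measure_ge0 andbT -A0 -(lebesgue_rV_reflect x mA).
  have mAx : measurable [set u | A (x - u)%R].
    have := measurable_xsection x mAB; by rewrite xsectionE.
  by apply: le_measure; rewrite ?inE//; exact: measurableI.
have [v v0 vE] := norm_ball_volume hN.
have D_gt0 : 0 < leb D.
  by rewrite (lebesgue_norm_lt hN n0 (ltW D0)) vE -EFinM lte_fin mulr_gt0// exprn_gt0.
(* Since [D] has positive volume, some [u] in it gives a translate of [A] of [mu]-measure 0. *)
move=> DA0; have [u Du /eqP muA] : exists2 u, D u & mu [set x | A (x - u)%R] == 0.
  apply: contrapT => H; move: D_gt0; rewrite -DA0 setIidl ?DA0 ?ltxx// => u Du /=.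
  rewrite setTI lt_neqAle measure_ge0 andbT eq_sym; apply/negP => muA.
  by apply: H; exists u.
apply/eqP; rewrite eq_le measure_ge0 andbT.
have := DP A u mA (ltW Du); rewrite image_shift => /le_trans; apply.
by rewrite [X in _ * X]muA mule0.
Qed.

Lemma DP_has_density (Delta eps : R)
    (mu : {finite_measure set 'rV[R]_n -> \bar R}) :
  (0 < Delta)%R -> eps_DP N Delta eps mu ->
  exists f : 'rV[R]_n -> R, has_density mu (EFin \o f).
Proof.
move=> D0 DP; have mul := DP_null_dominates D0 DP.
pose h := Radon_Nikodym_SigmaFinite.f mu leb.
exists (fine \o h).
(* The chosen Radon-Nikodym derivative is finite at every point, so [fine] loses nothing. *)
have -> : EFin \o (fine \o h) = h.
  by apply/funext => x /=; rewrite fineK//; exact: Radon_Nikodym_SigmaFinite.f_fin_num.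
split.
- exact: measurable_int (Radon_Nikodym_SigmaFinite.f_integrable mul).
- exact: Radon_Nikodym_SigmaFinite.f_ge0.
- exact: Radon_Nikodym_SigmaFinite.f_integral.
Qed.

End DP_density.

(** * Existence of the rearranged noise, its privacy, and stochastic domination *)

Theorem theorem4 (R : realType) (n : nat) (N : 'rV[R]_n -> R) (eps Delta : R)
    (d : measure_display) (T : measurableType d) (P : probability T R)
    (X : {RV P >-> 'rV[R]_n}) :
  (1 <= n)%N -> is_norm N -> 0 < eps -> 0 < Delta ->
  eps_DP N Delta eps (distribution P X) ->
  (exists (d' : measure_display) (T' : measurableType d')
     (P' : probability T' R) (Xs : {RV P' >-> 'rV[R]_n}),
     is_rearrangement N (distribution P X) (distribution P' Xs)) /\
  (forall (d' : measure_display) (T' : measurableType d')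
     (P' : probability T' R) (Xs : {RV P' >-> 'rV[R]_n}),
     is_rearrangement N (distribution P X) (distribution P' Xs) ->
     eps_DP N Delta eps (distribution P' Xs) /\
     stoch_dom P' P (N \o Xs) (N \o X)).
Proof.
move=> n0 hN eps0 D0 DP; set mu := distribution P X.
have muT : mu setT = 1%E by exact: probability_setT.
have muoo : (mu setT < +oo)%E by rewrite muT ltry.
split.
  have [f fmu] := DP_has_density hN n0 D0 DP.
  have g1 : (\int[lebesgue_rV R n]_x fun_star N f x = 1)%E.
    by rewrite (integral_fun_starT hN n0 fmu muoo).
  pose mg := measurable_fun_star hN n0 fmu; pose g0 := fun_star_ge0 hN n0 fmu.
  (* The rearranged vector is realised as the identity map on the space of row vectors, under the
     law with density [fun_star N f]. *)
  have mid : measurable_fun setT (@idfun 'rV[R]_n).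
    exact: (@measurable_id _ 'rV[R]_n setT).
  pose Y : {mfun 'rV[R]_n >-> 'rV[R]_n} :=
    HB.pack (@idfun 'rV[R]_n) (isMeasurableFun.Build _ _ _ _ _ mid).
  by exists _, 'rV[R]_n, (density_probability mg g0 g1), Y, f; split.
move=> d' T' P' Xs [f [fmu fnu]]; split; first exact: (eps_DP_star hN n0 fmu muoo DP).
have [_ _ nuE] := fnu.
move=> l l0; pose K := [set x | N x <= l].
have mK : measurable K by exact: measurable_norm_le.
(* Complements turn the comparison of tails into the reverse comparison of the masses of the closed
   ball [K]. *)
have KC d2 (T2 : measurableType d2) (Q : probability T2 R)
    (Y : {RV Q >-> 'rV[R]_n}) :
    Q [set t | l < (N \o Y) t] = (1 - distribution Q Y K)%E.
  rewrite -(probability_setC (distribution Q Y) mK).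
  by congr (Q _); apply/seteqP; split=> t /=; rewrite ltNge => /negP.
rewrite !KC; apply: leeB => //.
rewrite (nuE _ mK); exact: (norm_ball_density_star hN n0 fmu muoo).
Qed.
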